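(* Consider a linear ($\alpha=+\infty$) or quasi-linear ($\alpha=1$) Fisher market with data $(m,n,v,B)$ as in the context. The accelerated price-adjustment method (APM) finds an $\epsilon$-CE price vector in at most $\tilde{\mathcal O}(1/\sqrt{\epsilon})$ iterations. That is, for every such market and every initial point $\mu^0\in[\underline\mu,\bar\mu]^m$ there exist constants $C,k>0$ (independent of $\epsilon$) such that for every $\epsilon\in(0,\exp(\underline\mu-1)]$, APM run with accuracy $\epsilon$ from $\mu^0$ meets its stopping criterion at some iteration $\bar t\le C\,\epsilon^{-1/2}\,(\log(2+1/\epsilon))^{k}$, and at the iteration $\bar t$ where it stops, the price vector $p$ with $p_j=\exp(\mu^{\bar t}_j)$, $j\in[m]$, is an $\epsilon$-CE price vector.
   Context: Market. There are $m\ge1$ goods and $n\ge1$ buyers; $[m]=\{1,\dots,m\}$. Buyer $i$ has budget $B_i>0$, $B=(B_1,\dots,B_n)$, and the utility matrix $v=(v_{ij})\in\mathbb R^{n\times m}$ has nonnegative entries and no zero row or zero column. $v_i$ is the $i$-th row. A parameter $\alpha\in\{1,+\infty\}$ selects quasi-linear utilities ($\alpha=1$) or linear utilities ($\alpha=+\infty$). Conventions: $\alpha^{-1}=0$ if $\alpha=+\infty$; $v_{i0}=1$ for all $i$; $\mu_0=\log\alpha\in\{0,+\infty\}$; $\log 0=-\infty$; $\exp(-\infty)=0$. Bounds. $\bar p=(1-\alpha^{-1})\|B\|_1+\max_{i\in[n],j\in[m]}\alpha^{-1}v_{ij}$, $\ \underline p=\min_{j\in[m]}\max_{i\in[n]}\frac{v_{ij}B_i}{\|v_i\|_1+\alpha^{-1}B_i}$,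 $\ \underline\mu=\log\underline p$, $\ \bar\mu=\log\bar p$. Functions. For $\mu\in\mathbb R^m$ and $\delta>0$, $$F(\mu)=\sum_{j\in[m]}\exp(\mu_j)+\sum_{i\in[n]}B_i\max_{j\in\{0\}\cup[m]}\{\log(v_{ij})-\mu_j\},$$ $$F_\delta(\mu)=\sum_{j\in[m]}\exp(\mu_j)+\delta\sum_{i\in[n]}B_i\log\Big(\sum_{j\in\{0\}\cup[m]}\exp\big(\tfrac{\log(v_{ij})-\mu_j}{\delta}\big)\Big).$$ $\epsilon$-CE prices. A price vector $p$ (with positive entries) is an $\epsilon$-CE price vector if $\mu_j=\log p_j$, $j\in[m]$, satisfies $F(\mu)-\inf_{\mathbb R^m}F\le\epsilon$. APM with accuracy $\epsilon\in(0,\exp(\underline\mu-1)]$. Parameters: $\delta=\epsilon/(2\log(m+1)\|B\|_1)$, $\eta=1$, $L=\exp(\bar\mu+\eta)+\|B\|_1/\delta$, $\sigma=\exp(\underline\mu-\eta)$, $q=\sigma/L$. Initialization: $\mu^0\in[\underline\mu,\bar\mu]^m$, $y^0=\mu^0$. Iteration $t=0,1,2,\dots$: stop at iteration $t$ if $\|\nabla F_\delta(\mu^t)\|_2\le\min\{\sigma\epsilon,\sqrt{\sigma\epsilon}\}$; otherwise set $$\mu^{t+1}_j=\max\{\underline\mu-\eta,\min\{y^t_j-\tfrac1L\nabla_jF_\delta(y^t),\ \bar\mu+\eta\}\},\ j\in[m];\qquad y^{t+1}=\mu^{t+1}+\frac{1-\sqrt q}{1+\sqrt q}(\mu^{t+1}-\mu^t).$$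 *)

(* Defs.v *)
From HB Require Import structures.
From mathcomp Require Import all_boot all_order all_algebra.
From mathcomp Require Import all_classical all_reals all_analysis.
Set Implicit Arguments.
Unset Strict Implicit.
Unset Printing Implicit Defensive.
Import Order.TTheory GRing.Theory Num.Theory.
Import numFieldNormedType.Exports.
Local Open Scope classical_set_scope.
Local Open Scope ring_scope.

Section Norms.
Context {R : realType}.

Definition norm1 k (x : 'rV[R]_k) : R := \sum_(j < k) `|x ord0 j|.
Definition norm2 k (x : 'rV[R]_k) : R := Num.sqrt (\sum_(j < k) x ord0 j ^+ 2).

(* The library norm on 'rV[R]_k is the sup norm, but directional derivatives
   do not depend on the choice of the norm. *)
Definition grad k (f : 'rV[R]_k -> R) (x : 'rV[R]_k) : 'rV[R]_k :=
  \row_(j < k) 'D_(delta_mx ord0 j) (f : 'rV[R]_k -> R^o) x.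

(* For a nonempty finite index type these are the maximum and the minimum. *)
Definition fmax (I : finType) (f : I -> R) : R := sup (range f).
Definition fmin (I : finType) (f : I -> R) : R := inf (range f).

End Norms.

Section Market.
Context {R : realType} {m n : nat}.
Variables (alpha : \bar R) (B : 'rV[R]_n) (v : 'M[R]_(n, m)).

(* (+oo)^-1 = 0 in \bar R *)
Definition alphaV : R := fine (alpha^-1)%E.

(* The index set {0} \cup [m] is [option 'I_m], with [None] in the role of 0. *)
Definition val0 (i : 'I_n) (j : option 'I_m) : R :=
  if j is Some j' then v i j' else 1.
Definition logprice0 (mu : 'rV[R]_m) (j : option 'I_m) : \bar R :=
  if j is Some j' then (mu ord0 j')%:E else lne alpha.

(* log(v_ij) - mu_j, with value -oo if v_ij = 0 or mu_j = +oo *)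
Definition log_bang (mu : 'rV[R]_m) (i : 'I_n) (j : option 'I_m) : \bar R :=
  (lne (val0 i j)%:E - logprice0 mu j)%E.

Definition F (mu : 'rV[R]_m) : \bar R :=
  ((\sum_(j < m) expR (mu ord0 j))%:E +
   \sum_(i < n) (B ord0 i)%:E *
     \big[maxe/-oo]_(j : option 'I_m) log_bang mu i j)%E.

(* Each expeR below is finite when 0 < delta. *)
Definition Fdelta (delta : R) (mu : 'rV[R]_m) : R :=
  \sum_(j < m) expR (mu ord0 j) +
  delta * \sum_(i < n) B ord0 i *
    ln (\sum_(j : option 'I_m) fine (expeR (log_bang mu i j / delta%:E)%E)).

Definition pbar : R :=
  (1 - alphaV) * norm1 B +
  fmax (fun ij : 'I_n * 'I_m => alphaV * v ij.1 ij.2).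
Definition punder : R :=
  fmin (fun j : 'I_m => fmax (fun i : 'I_n =>
    v i j * B ord0 i / (norm1 (row i v) + alphaV * B ord0 i))).
Definition muunder : R := ln punder.
Definition mubar : R := ln pbar.

Definition eps_CE_price (eps : R) (p : 'rV[R]_m) : Prop :=
  (forall j, 0 < p ord0 j) /\
  (F (map_mx (@ln R) p) - ereal_inf (range F) <= eps%:E)%E.

Definition apm_delta (eps : R) : R := eps / (2 * ln m.+1%:R * norm1 B).
Definition apm_eta : R := 1.
Definition apm_L (eps : R) : R :=
  expR (mubar + apm_eta) + norm1 B / apm_delta eps.
Definition apm_sigma : R := expR (muunder - apm_eta).
Definition apm_q (eps : R) : R := apm_sigma / apm_L eps.

Definition apm_grad (eps : R) : 'rV[R]_m -> 'rV[R]_m :=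
  grad (Fdelta (apm_delta eps)).

Definition apm_stop (eps : R) (mu : 'rV[R]_m) : Prop :=
  norm2 (apm_grad eps mu) <=
  Num.min (apm_sigma * eps) (Num.sqrt (apm_sigma * eps)).

Definition apm_next_mu (eps : R) (y : 'rV[R]_m) : 'rV[R]_m :=
  \row_(j < m) Num.max (muunder - apm_eta)
    (Num.min (y ord0 j - (apm_L eps)^-1 * apm_grad eps y ord0 j)
             (mubar + apm_eta)).

Definition apm_step (eps : R) (s : 'rV[R]_m * 'rV[R]_m) :
    'rV[R]_m * 'rV[R]_m :=
  let mu' := apm_next_mu eps s.2 in
  let q := apm_q eps in
  (mu', mu' + ((1 - Num.sqrt q) / (1 + Num.sqrt q)) *: (mu' - s.1)).

(* The pair (mu^t, y^t), continued past the stopping test; only the iterates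
   up to the first success of the test belong to the run of APM. *)
Definition apm_state (eps : R) (mu0 : 'rV[R]_m) (t : nat) :
    'rV[R]_m * 'rV[R]_m :=
  iter t (apm_step eps) (mu0, mu0).
Definition apm_mu (eps : R) (mu0 : 'rV[R]_m) (t : nat) : 'rV[R]_m :=
  (apm_state eps mu0 t).1.

Definition apm_stops_at (eps : R) (mu0 : 'rV[R]_m) (t : nat) : Prop :=
  apm_stop eps (apm_mu eps mu0 t) /\
  forall s : nat, (s < t)%N -> ~ apm_stop eps (apm_mu eps mu0 s).

End Market.

(* Main.v *)
Require Import Defs.
From mathcomp Require Import all_boot all_order all_algebra.
From mathcomp Require Import all_classical all_reals all_analysis.
From mathcomp Require Import ring lra.
Set Implicit Arguments.
Unset Strict Implicit.
Unset Printing Implicit Defensive.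
Import Order.TTheory GRing.Theory Num.Theory.
Import numFieldNormedType.Exports.
Local Open Scope classical_set_scope.
Local Open Scope ring_scope.

(** The smoothed objective Phi = F_delta lies between F and F + eps / 2. It is
    the sum of the exponentials exp(mu_j) and of a convex log-sum-exp term G,
    and the second derivative of G in a direction h is at most
    Lam / 2 * |h|^2, where Lam = |B|_1 / delta [ln_sum_expR_le]. All of the
    analysis is done on Bregman remainders: bounds on Phi(x) minus its tangent
    at y replace second derivatives [Fdelta_ge], [Fdelta_le].

    Why the stopping test is sufficient. Let lo and hi be the bounds of the box
    of the projection. On the box exp(mu_j) >= sigma, so Phi is sigma-strongly
    convex there, and |grad Phi(mu)|^2 <= sigma eps bounds the distance of
    Phi(mu) from its minimum by eps / 2 [gap_of_stop]. This uses that the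
    minimum of Phi over the box is its minimum over the whole space
    [Fdelta_minimizer]. At the upper bound of the box demand is too small. At
    the lower bound, the first-order conditions say that no good is paid more
    than its price; if some price were equal to exp(lo), then a buyer who
    likes that good could not have spent the whole budget
    [box_minimizer_gt_lo].

    Why the iteration is fast. The extrapolated points y can leave the box, and
    outside it neither the smoothness constant L nor the strong convexity
    constant sigma is valid. Above the box, each price is followed separately:
    the only force that raises log-price x is bounded by that of the potential
    exp(x) - |B|_1 x, so the potential plus the kinetic energy
    L / 2 * (y - x)^2 of an upward move never exceeds the potential at lo
    [upward_energy_step], which keeps exp(y) below L - Lam / 2
    [overshoot_le]. As G only consumes Lam / 2 of the curvature, the descent
    inequality holds with the constant L at every point that is visited. Below
    the box, y stays above lo - w with w = hi - lo, hence strong convexity holds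
    with theta * sigma, theta = exp(- w). The momentum is tuned to sigma and
    not to theta * sigma, so the usual estimate-sequence argument does not
    close; but adding the squared distance of the iterate to that of the
    estimate point, with equal weights, gives a Lyapunov function that
    contracts by 1 - theta * sqrt q / 8 in every step
    [contraction_coord], [lyapunov_step].

    Since L is O(1 / eps), q is of order eps, and the Lyapunov function has to
    fall from O(1) to a power of eps, which takes O(eps^(-1/2) log (1 / eps))
    steps [iteration_count]. *)

(** * Bregman remainders of exp and of log-sum-exp *)

(** Only the sign of f' between a and b enters, so one statement serves both
    orders of a and b; it turns second-derivative bounds into the Bregman
    inequalities below. *)
Lemma minimum_of_derive_sign (R : realType) (f f' : R -> R) (a b : R) :
  (forall t : R, is_derive t 1 f (f' t)) ->
  (forall t, (b <= t <= a) || (a <= t <= b) -> 0 <= f' t * (t - b)) ->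
  f b <= f a.
Proof.
move=> df sgn.
have cf c d : {within `[c, d], continuous f}.
  apply: continuous_subspaceT => t.
  by apply/differentiable_continuous/derivable1_diffP; case: (df t).
have [ab|ba|->//] := ltgtP a b.
- have [c /itvP cab eq_f] := MVT ab (fun t _ => df t) (cf _ _).
  have ac : a < c by rewrite cab.
  have cb : c < b by rewrite cab.
  have := sgn c; rewrite (ltW ac) (ltW cb) orbT => /(_ isT); nra.
- have [c /itvP cab eq_f] := MVT ba (fun t _ => df t) (cf _ _).
  have ac : c < a by rewrite cab.
  have cb : b < c by rewrite cab.
  have := sgn c; rewrite (ltW ac) (ltW cb) => /(_ isT); nra.
Qed.


Lemma expR_tangent_le (R : realType) (a b : R) :
  expR b + expR b * (a - b) <= expR a.
Proof.
have -> : expR a = expR b * expR (a - b) by rewrite -expRD subrKC.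
have := expR_ge1Dx (a - b); have := expR_gt0 b; nra.
Qed.

Lemma expR_bregman_le (R : realType) (M a b : R) :
  expR a <= M -> expR b <= M ->
  expR a - expR b - expR b * (a - b) <= M / 2 * (a - b) ^+ 2.
Proof.
move=> aM bM.
pose f t := M / 2 * (t - b) ^+ 2 - (expR t - expR b - expR b * (t - b)).
suff : f b <= f a by rewrite /f !subrr expr0n /= !mulr0 !subr0 subr_ge0.
apply: (@minimum_of_derive_sign _ f (fun t => M * (t - b) - (expR t - expR b))).
  by move=> t; apply: is_derive_eq; rewrite /GRing.scale /=; field.
move=> t tab.
have tM : expR t <= M.
  case/orP: tab => /andP[h1 h2].
    by rewrite (le_trans _ aM)// ler_expR.
  by rewrite (le_trans _ bM)// ler_expR.
have tg := expR_tangent_le b t.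
case/orP: tab => /andP[h1 h2].
  rewrite mulr_ge0 ?subr_ge0//.
  have : expR t * (t - b) <= M * (t - b) by rewrite ler_wpM2r ?subr_ge0.
  lra.
rewrite mulr_le0 ?subr_le0//.
have := expR_tangent_le t b.
have : expR b * (b - t) <= M * (b - t) by rewrite ler_wpM2r ?subr_ge0.
lra.
Qed.

(** Strong convexity of exp as long as both points stay away from - oo. *)
Lemma expR_bregman_ge (R : realType) (m a b : R) :
  m <= expR a -> m <= expR b ->
  m / 2 * (a - b) ^+ 2 <= expR a - expR b - expR b * (a - b).
Proof.
move=> ma mb.
pose f t := (expR t - expR b - expR b * (t - b)) - m / 2 * (t - b) ^+ 2.
suff : f b <= f a by rewrite /f !subrr expr0n /= !mulr0 !subr0 subr_ge0.
apply: (@minimum_of_derive_sign _ f (fun t => (expR t - expR b) - m * (t - b))).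
  by move=> t; apply: is_derive_eq; rewrite /GRing.scale /=; field.
move=> t tab.
have mt : m <= expR t.
  case/orP: tab => /andP[h1 h2].
    by rewrite (le_trans mb)// ler_expR.
  by rewrite (le_trans ma)// ler_expR.
have tg := expR_tangent_le t b.
case/orP: tab => /andP[h1 h2].
  rewrite mulr_ge0 ?subr_ge0//.
  have : m * (t - b) <= expR b * (t - b) by rewrite ler_wpM2r ?subr_ge0.
  lra.
rewrite mulr_le0 ?subr_le0//.
have := expR_tangent_le b t.
have : m * (b - t) <= expR t * (b - t) by rewrite ler_wpM2r ?subr_ge0.
lra.
Qed.

Section LogSumExp.
Context {R : realType} {I : finType}.
Implicit Types p z : I -> R.

(** The expansion of the double sum of p_k p_l (z_k + z_l)^2 over k <> l, which
    is nonnegative, bounds the variance by 2 * sum (p_k - p_k^2) z_k^2, and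
    p - p^2 <= 1 / 4. The constant 1 / 2, half of the trivial one, is the
    curvature reserve on which the control of the overshoot relies. *)
Lemma variance_le p z : (forall k, 0 <= p k) -> \sum_k p k = 1 ->
  \sum_k p k * z k ^+ 2 - (\sum_k p k * z k) ^+ 2 <= 2^-1 * \sum_k z k ^+ 2.
Proof.
move=> p0 p1; set c := \sum_k p k * z k; set s := \sum_k p k * z k ^+ 2.
have diag : \sum_k 4 * (p k * z k) ^+ 2 <=
    \sum_k \sum_l p k * p l * (z k + z l) ^+ 2.
  apply: ler_sum => k _; rewrite (bigD1 k)//= -subr_ge0.
  rewrite (_ : _ - _ = \sum_(l | l != k) p k * p l * (z k + z l) ^+ 2); last ring.
  by apply: sumr_ge0 => l _; rewrite mulr_ge0 ?sqr_ge0// mulr_ge0.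
have full : \sum_k \sum_l p k * p l * (z k + z l) ^+ 2 = 2 * s + 2 * c ^+ 2.
  have E k : \sum_l p k * p l * (z k + z l) ^+ 2 =
      p k * z k ^+ 2 + 2 * c * (p k * z k) + s * p k.
    transitivity (p k * z k ^+ 2 * \sum_l p l + 2 * (p k * z k) * c + p k * s).
      by rewrite !mulr_sumr -!big_split/=; apply: eq_bigr => l _; ring.
    by rewrite p1; ring.
  rewrite (eq_bigr _ (fun k _ => E k)) !big_split/= -!mulr_sumr p1 -/s -/c.
  ring.
have main : \sum_k (4 * p k * z k ^+ 2 - 4 * (p k * z k) ^+ 2) <= \sum_k z k ^+ 2.
  apply: ler_sum => k _.
  by have := sqr_ge0 ((2 * p k - 1) * z k); lra.
have E1 : \sum_k (4 * p k * z k ^+ 2 - 4 * (p k * z k) ^+ 2) =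
   4 * s - \sum_k 4 * (p k * z k) ^+ 2.
  by rewrite sumrB mulr_sumr; congr (_ - _); apply: eq_bigr => k _; ring.
move: diag; rewrite full; move: main; rewrite E1; lra.
Qed.

Lemma is_derive_fin_sum (f : I -> R -> R) (df : I -> R) (t : R) :
  (forall k, is_derive t 1 (f k) (df k)) ->
  is_derive t (1 : R) (fun t => \sum_k f k t) (\sum_k df k).
Proof.
move=> H; rewrite -fct_sumE.
elim/big_rec2 : _ => [|k y1 y2 _ IH]; first exact: is_derive_cst.
by apply: is_deriveD.
Qed.

(** Jensen's inequality. *)
Lemma ln_sum_expR_ge p z : (forall k, 0 <= p k) -> \sum_k p k = 1 ->
  \sum_k p k * z k <= ln (\sum_k p k * expR (z k)).
Proof.
move=> p0 p1; set c := \sum_k p k * z k.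
rewrite -ler_expR.
have H : expR c <= \sum_k p k * expR (z k).
  apply: (@le_trans _ _ (\sum_k p k * (expR c + expR c * (z k - c)))).
    rewrite (eq_bigr (fun k => expR c * (1 - c) * p k + expR c * (p k * z k))).
      by rewrite big_split/= -!mulr_sumr p1 -/c; lra.
    by move=> k _; ring.
  by apply: ler_sum => k _; rewrite ler_wpM2l ?expR_tangent_le.
by rewrite lnK// posrE (lt_le_trans _ H)// expR_gt0.
Qed.

(** A form of Hoeffding's lemma: t |-> ln (sum p_k exp(t z_k)) has the mean of z
    as derivative at 0, and its second derivative is a variance under tilted
    weights, hence at most half of sum z_k^2. Two integrations give the
    bound. *)
Lemma ln_sum_expR_le p z : (forall k, 0 <= p k) -> \sum_k p k = 1 ->
  ln (\sum_k p k * expR (z k)) <= \sum_k p k * z k + 4^-1 * \sum_k z k ^+ 2.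
Proof.
move=> p0 p1.
pose N r t := \sum_k p k * z k ^+ r * expR (t * z k).
have dN r (t : R) : is_derive t 1 (N r) (N r.+1 t).
  apply: (is_derive_fin_sum (f := fun k t => p k * z k ^+ r * expR (t * z k))).
  move=> k; apply: is_derive_eq.
  by rewrite /GRing.scale/= exprS; ring.
have N0_gt0 t : 0 < N 0 t.
  have := @ln_sum_expR_ge p (fun k => t * z k) p0 p1.
  rewrite lt_neqAle andbC sumr_ge0 => [|k _]/=; last first.
    by rewrite expr0 mulr1 mulr_ge0 ?p0 ?expR_ge0.
  move=> _; apply/eqP => N00.
  have : \sum_k p k * expR (t * z k) = 0.
    by rewrite [RHS]N00; apply: eq_bigr => k _; rewrite expr0 mulr1.
  move=> /eqP; rewrite psumr_eq0; last by move=> k _; rewrite mulr_ge0 ?p0 ?expR_ge0.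
  move=> /allP E; have : \sum_k p k = 0.
    apply: big1 => k _; have := E k (mem_index_enum _).
    by rewrite mulf_eq0 [expR _ == 0]gt_eqF ?expR_gt0// orbF => /eqP.
  by rewrite p1 => /eqP; rewrite oner_eq0.
pose D t := N 1 t / N 0 t.
set S := \sum_k z k ^+ 2.
have dlnN (t : R) : is_derive t 1 (fun t => ln (N 0 t)) (D t).
  have dl := is_derive1_ln (N0_gt0 t).
  have := @is_derive1_comp _ _ (N 0) t _ _ dl (dN 0 t).
  by rewrite mulrC.
have dD (t : R) : is_derive t 1 D (N 2 t / N 0 t - D t ^+ 2).
  have Nt0 : N 0 t != 0 by rewrite gt_eqF.
  have dV := @is_deriveV _ (N 0) t (N 1 t) 1 Nt0 (dN 0 t).
  have dM : is_derive t 1 D _ := is_deriveM (dN 1 t) dV.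
  apply: (is_derive_eq dM); rewrite /D /GRing.scale/=; field.
  exact: Nt0.
have D_sub (t : R) : 0 <= t -> D t - D 0 <= 2^-1 * S * t.
  move=> t0; pose f t := 2^-1 * S * t - D t.
  suff : f 0 <= f t by rewrite /f; lra.
  apply: (@minimum_of_derive_sign _ f (fun u => 2^-1 * S - (N 2 u / N 0 u - D u ^+ 2))).
    by move=> u; apply: is_derive_eq; rewrite /GRing.scale /=; ring.
  move=> u /orP[] /andP[u0 ut]; last first.
    by rewrite (_ : u = 0) ?subrr ?mulr0//; apply/eqP; rewrite eq_le ut (le_trans t0).
  rewrite subr0 mulr_ge0// subr_ge0.
  pose q k := p k * expR (u * z k) / N 0 u.
  have q0 k : 0 <= q k by rewrite divr_ge0 ?mulr_ge0 ?expR_ge0// ltW.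
  have q1 : \sum_k q k = 1.
    rewrite -mulr_suml -[X in X / _](_ : N 0 u = _) ?divff ?gt_eqF//.
    by apply: eq_bigr => k _; rewrite expr0 mulr1.
  have := variance_le z q0 q1.
  rewrite (_ : \sum_k q k * z k ^+ 2 = N 2 u / N 0 u); last first.
    by rewrite mulr_suml; apply: eq_bigr => k _; rewrite /q; ring.
  rewrite (_ : \sum_k q k * z k = D u)//.
  by rewrite /D mulr_suml; apply: eq_bigr => k _; rewrite /q expr1; ring.
pose f t := 4^-1 * S * t ^+ 2 + D 0 * t - ln (N 0 t).
have : f 0 <= f 1.
  apply: (@minimum_of_derive_sign _ f (fun u => 2^-1 * S * u + D 0 - D u)).
    move=> u; have := dlnN u => ?; apply: is_derive_eq.
    by rewrite /GRing.scale /=; field.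
  move=> u /orP[] /andP[u0 u1]; last first.
    by rewrite (_ : u = 0) ?subrr ?mulr0//; apply/eqP; rewrite eq_le u1 (le_trans ler01).
  by rewrite subr0 mulr_ge0//; have := D_sub _ u0; lra.
have N00 : N 0 0 = 1.
  by rewrite -p1; apply: eq_bigr => k _; rewrite expr0 mul0r expR0; ring.
have N01 : N 0 1 = \sum_k p k * expR (z k).
  by apply: eq_bigr => k _; rewrite expr0 mul1r mulr1.
have D0 : D 0 = \sum_k p k * z k.
  rewrite /D N00 divr1; apply: eq_bigr => k _.
  by rewrite expr1 mul0r expR0 mulr1.
rewrite /f N00 N01 ln1 -/S D0; lra.
Qed.
End LogSumExp.

(** * Numerical constants *)

Lemma expR1_ge (R : realType) : 27 / 10 <= expR 1 :> R.
Proof.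
have h : 145 / 128 <= expR 8^-1 :> R.
  have := @expR_bregman_ge R 1 8^-1 0.
  rewrite expR0 lexx; have := @expR_ge1Dx R 8^-1 => h1 h2.
  have := h2 ltac:(lra) isT; lra.
rewrite [X in expR X](_ : 1 = 8%:R * 8^-1); last by field.
rewrite expRM_natl; apply: (@le_trans _ _ ((145 / 128) ^+ 8)); last first.
  by rewrite lerXn2r ?nnegrE ?expR_ge0//; lra.
rewrite !exprS expr0; lra.
Qed.

Lemma ln2_ge (R : realType) : 2 / 3 <= ln 2 :> R.
Proof.
have h : 15^-1 <= ln (15 / 14) :> R.
  have := @le_ln1Dx R (- 15^-1) ltac:(lra).
  rewrite (_ : 1 + - 15^-1 = (15 / 14)^-1); last by field.
  rewrite lnV ?posrE; lra.
apply: (@le_trans _ _ (ln ((15 / 14) ^+ 10))).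
  rewrite lnXn; last lra.
  rewrite -mulr_natr; lra.
rewrite ler_ln ?posrE ?exprn_gt0//; lra.
Qed.

Lemma ln_le_div_expR1 (R : realType) (z : R) : 0 < z -> ln z <= z / expR 1.
Proof.
move=> z0; have E0 := expR_gt0 (1 : R).
have zE0 : 0 < z / expR 1 by rewrite divr_gt0.
have := @expR_ge1Dx R (ln (z / expR 1)).
rewrite lnK ?posrE// lnM ?posrE ?invr_gt0// lnV ?posrE// expRK; lra.
Qed.

(** The inequality of [overshoot_gap] in units of the total budget, with
    r = b / p and s = p / b; 371 / 1000 stands for an upper bound on 1 / e. *)
Lemma overshoot_gap_normalized (R : realType) (r s y : R) :
  r * s = 1 -> 1 <= r -> 0 < s -> s <= 1 -> 18 / 10 * r + 27 / 10 * s <= y ->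
  (y - 1) ^+ 2 < (2 * y + 36 / 10 * r) *
    (y - 371 / 1000 * (y + r) - 1 - 371 / 1000 * s).
Proof.
move=> rs r1 s0 s1 hy.
pose h := y - 18 / 10 * r - 27 / 10 * s.
have h0 : 0 <= h by rewrite /h; lra.
have Ey : y = 18 / 10 * r + 27 / 10 * s + h by rewrite /h; ring.
have rh : 0 <= r * h by rewrite mulr_ge0 //; lra.
have sh : 0 <= s * h by rewrite mulr_ge0 // ltW.
have ss : s ^+ 2 <= 1 by rewrite expr_le1 // ltW.
have rr := sqr_ge0 (r - 9 / 10); have r2 := sqr_ge0 r.
have hh := sqr_ge0 h.
by rewrite Ey; clearbody h; lra.
Qed.

(** In the potential h(t) = exp(t) - b t, a log-price with the energy
    h(ln p - 1) can reach the level ln Y in one step only if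
    2 L (h(ln Y) - h(ln p - 1)) <= h'(ln Y)^2. With L = e P + Lam the factor 2 L
    is 2 Y + Lam, so this inequality puts the level Y out of reach. *)
Lemma overshoot_gap (R : realType) (p P b Lam Y : R) :
  0 < p -> p <= P -> p <= b -> 4 / 3 * expR 1 * (b ^+ 2 / p) <= Lam ->
  Y = expR 1 * P + Lam / 2 ->
  (Y - b) ^+ 2 <
  (2 * Y + Lam) * (Y - b * (ln Y - ln p) - b - p / expR 1).
Proof.
move=> p0 pP pb hLam defY.
have E27 := @expR1_ge R; set E := expR 1 in E27 hLam defY *.
have b0 : 0 < b by lra.
pose r := b / p; pose s := p / b; pose l := Lam / b; pose y := Y / b.
have rs : r * s = 1 by rewrite /r /s; field; rewrite !gt_eqF.
have r0 : 0 < r by rewrite divr_gt0.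
have s0 : 0 < s by rewrite divr_gt0.
have s1 : s <= 1 by rewrite ler_pdivrMr ?mul1r.
have r1 : 1 <= r by rewrite ler_pdivlMr ?mul1r.
have l36 : 36 / 10 * r <= l.
  rewrite /l ler_pdivlMr//; apply: le_trans hLam.
  rewrite (_ : 36 / 10 * r * b = 36 / 10 * (b ^+ 2 / p)); last by rewrite /r; ring.
  by rewrite ler_wpM2r ?divr_ge0 ?sqr_ge0 ?(ltW p0)//; lra.
have hy : 27 / 10 * s + l / 2 <= y.
  rewrite /y defY /l [X in _ <= X]mulrDl; apply: lerD; last by rewrite mulrAC.
  rewrite /s mulrA ler_wpM2r ?invr_ge0 ?(ltW b0)//.
  by apply: ler_pM; lra.
have y0 : 0 < y by lra.
have EY : Y = y * b by rewrite /y divfK ?gt_eqF.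
have Ep : p = s * b by rewrite /s divfK ?gt_eqF.
have El : Lam = l * b by rewrite /l divfK ?gt_eqF.
have iE : E^-1 <= 371 / 1000.
  by rewrite invf_ple ?posrE; lra.
have lnb : ln Y - ln p <= 371 / 1000 * (y + r).
  have -> : ln Y - ln p = ln y + ln r.
    rewrite -ln_div ?posrE//; last by rewrite EY mulr_gt0.
    rewrite -lnM ?posrE//; congr (ln _).
    by rewrite EY /r; field; rewrite gt_eqF.
  have := ln_le_div_expR1 y0; have := ln_le_div_expR1 r0; rewrite -/E.
  have : y * E^-1 <= y * (371 / 1000) by rewrite ler_wpM2l ?(ltW y0).
  have : r * E^-1 <= r * (371 / 1000) by rewrite ler_wpM2l ?(ltW r0).
  lra.
pose A := y - 371 / 1000 * (y + r) - 1 - 371 / 1000 * s.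
have hA : A * b <= Y - b * (ln Y - ln p) - b - p / E.
  have : b * (ln Y - ln p) <= b * (371 / 1000 * (y + r)) by rewrite ler_wpM2l ?(ltW b0).
  have : p * E^-1 <= p * (371 / 1000) by rewrite ler_wpM2l ?(ltW p0).
  by rewrite EY [in p * (371 / 1000)]Ep /A; lra.
have rs2 : 2 <= r + s by have := sqr_ge0 (r - s); nra.
have A0 : 0 < A by rewrite /A; lra.
have main : (y - 1) ^+ 2 < (2 * y + 36 / 10 * r) * A.
  by apply: overshoot_gap_normalized => //; lra.
have main2 : (y - 1) ^+ 2 < (2 * y + l) * A.
  by apply: (lt_le_trans main); rewrite ler_wpM2r ?(ltW A0)// lerD2l.
have -> : (Y - b) ^+ 2 = (y - 1) ^+ 2 * b ^+ 2 by rewrite EY; ring.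
apply: (@lt_le_trans _ _ ((2 * Y + Lam) * (A * b))).
  have -> : (2 * Y + Lam) * (A * b) = (2 * y + l) * A * b ^+ 2.
    by rewrite [in LHS]EY [in LHS]El; ring.
  by rewrite ltr_pM2r ?exprn_gt0.
apply: ler_wpM2l => //.
have Y0 : 0 < Y by rewrite EY mulr_gt0.
have Lam0 : 0 < Lam by rewrite El mulr_gt0//; apply: lt_le_trans l36; lra.
by rewrite addr_ge0 ?mulr_ge0 ?ltW.
Qed.

(** * Overshoot of one log-price *)

(** An energy balance for an accelerated step with momentum factor beta, in one
    coordinate. The gradient g is at least h'(y), so an upward move of x is not
    longer than for the potential h. If x' does not pass beyond y, convexity
    alone gives the energy decrease: exp(x') - exp(x) <= exp(y) * (x' - x). This
    is what makes the argument independent of how far y is above hi. If x' > y,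
    the points are below hi and the smoothness constant L applies. A move that
    changes direction starts with kinetic energy 0. *)
Lemma upward_energy_step (R : realType) (b L lo hi x y g beta : R) :
  lo <= x <= hi -> 0 < L -> expR hi <= L -> expR y - b <= g ->
  0 <= beta <= 1 ->
  let h t := expR t - b * t in
  let x' := Num.max lo (Num.min (y - L^-1 * g) hi) in
  let y' := x' + beta * (x' - x) in
  y <= x \/ h x + L / 2 * (y - x) ^+ 2 <= h lo ->
  y' <= x' \/ h x' + L / 2 * (y' - x') ^+ 2 <= h lo.
Proof.
move=> /andP[lox xhi] L0 hiL hg /andP[b0 b1] h x' y' inv.
have [x'x|xx'] := leP x' x.
  by left; rewrite /y' gerDl mulr_ge0_le0// subr_le0.
right.
have x'hi : x' <= hi.
  by rewrite /x' ge_max ge_min lexx orbT (le_trans lox xhi).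
have x'y : x' <= y - L^-1 * g.
  have : lo < x' by apply: le_lt_trans xx'.
  rewrite /x' lt_max ltxx/= => lom.
  by rewrite ge_max (ltW (lt_le_trans lom _)) ?ge_min ?lexx.
have {x'y hg} hy : expR y - b <= L * (y - x').
  apply: (le_trans hg); move: x'y; rewrite lerBrDl -lerBrDr => x'y.
  by rewrite -ler_pdivrMl.
pose s := Num.max 0 (y - x); pose z := x + s.
have s0 : 0 <= s by rewrite /s le_max lexx.
have hz : expR z - b <= L * (z - x').
  rewrite /z /s; have [yx|xy] := leP (y - x) 0; last by rewrite subrKC.
  rewrite addr0.
  have yx' : y <= x by rewrite -subr_le0.
  have := expR_tangent_le y x.
  have : expR x * (x - y) <= L * (x - y).
    rewrite ler_wpM2r ?subr_ge0//.
    by apply: (le_trans _ hiL); rewrite ler_expR.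
  by move: hy; lra.
have step : h x' + L / 2 * (x' - x) ^+ 2 <= h x + L / 2 * s ^+ 2.
  have zs : z - x = s by rewrite /z; ring.
  have d0 : 0 <= x' - x by rewrite subr_ge0 ltW.
  have hd : (expR z - b) * (x' - x) <= L * (z - x') * (x' - x).
    by rewrite ler_wpM2r.
  have [x'z|zx'] := leP x' z.
    have t1 := expR_tangent_le x x'.
    have t2 : expR x' * (x' - x) <= expR z * (x' - x).
      by rewrite ler_wpM2r// ler_expR.
    have : 0 <= L / 2 * (s - (x' - x)) ^+ 2.
      by apply: mulr_ge0; [rewrite divr_ge0// ltW|exact: sqr_ge0].
    move: hd; rewrite /h -zs; lra.
  have t1 := expR_tangent_le x z.
  have t2 : expR x' - expR z - expR z * (x' - z) <= L / 2 * (x' - z) ^+ 2.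
    apply: expR_bregman_le; apply: (le_trans _ hiL); rewrite ler_expR//.
    by rewrite (le_trans (ltW zx')).
  move: hd; rewrite /h -zs; lra.
have hs : h x + L / 2 * s ^+ 2 <= h lo.
  case: inv => [yx|inv]; last first.
    have [yx|xy] := leP (y - x) 0; last by rewrite /s max_r ?(ltW xy).
    rewrite /s max_l// expr0n mulr0 addr0; apply: le_trans inv.
    by rewrite lerDl mulr_ge0 ?sqr_ge0// divr_ge0// ltW.
  have s_eq0 : s = 0 by rewrite /s max_l// subr_le0.
  rewrite s_eq0 expr0n mulr0 addr0.
  (* The move starts from rest, so the force at x points upwards and the convex
     potential decreases from lo to x. *)
  have slope_x : expR x < b.
    move: hz; rewrite /z s_eq0 addr0.
    have : 0 < L * (x' - x) by rewrite mulr_gt0// subr_gt0.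
    lra.
  have := expR_tangent_le lo x.
  have : 0 <= (b - expR x) * (x - lo) by rewrite mulr_ge0 ?subr_ge0// ltW.
  rewrite /h; lra.
have {}hs : h x' + L / 2 * (x' - x) ^+ 2 <= h lo by exact: le_trans step hs.
apply: le_trans hs; rewrite lerD2l ler_wpM2l ?divr_ge0 ?(ltW L0)//.
rewrite /y' addrC addKr exprMn ler_piMl ?sqr_ge0//.
by rewrite expr_le1.
Qed.

(** If y were higher, a shorter move from x would end exactly at the level Y,
    against [overshoot_gap]. *)
Lemma overshoot_le (R : realType) (p P b Lam x y : R) :
  0 < p -> p <= P -> p <= b -> 4 / 3 * expR 1 * (b ^+ 2 / p) <= Lam ->
  let L := expR 1 * P + Lam in
  let h t := expR t - b * t in
  x <= ln P + 1 ->
  y <= x \/ h x + L / 2 * (y - x) ^+ 2 <= h (ln p - 1) ->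
  expR y <= expR 1 * P + Lam / 2.
Proof.
move=> p0 pP pb hLam L h xhi inv.
set Y := (X in _ <= X).
have P0 : 0 < P by apply: lt_le_trans pP.
have Lam0 : 0 < Lam.
  apply: lt_le_trans hLam.
  by rewrite !mulr_gt0 ?expR_gt0 ?invr_gt0// (lt_le_trans p0).
have xP : expR x <= expR 1 * P.
  rewrite -[P in leRHS]lnK ?posrE// -expRD ler_expR; lra.
have Y0 : 0 < Y by rewrite /Y addr_gt0 ?mulr_gt0 ?expR_gt0 ?invr_gt0.
rewrite leNgt; apply/negP => Yy.
have lnYy : ln Y < y by rewrite -ltr_expR lnK.
have xlnY : x < ln Y.
  by rewrite -ltr_expR lnK// /Y; lra.
case: inv => [yx|inv]; first by move: (lt_trans xlnY lnYy); rewrite ltNge yx.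
have gap := overshoot_gap p0 pP pb hLam (erefl Y).
have L0 : 0 < L by rewrite addr_gt0// mulr_gt0 ?expR_gt0.
have E2L : 2 * Y + Lam = 2 * L by rewrite /Y /L; field.
pose s := ln Y - x.
have inv' : h x + L / 2 * s ^+ 2 <= h (ln p - 1).
  apply: le_trans inv; rewrite lerD2l ler_wpM2l ?divr_ge0 ?(ltW L0)//.
  by rewrite lerXn2r ?nnegrE /s; lra.
have := expR_tangent_le x (ln Y); rewrite lnK// => tg.
have hlo : h (ln p - 1) = p / expR 1 - b * (ln p - 1).
  by rewrite /h expRB lnK.
move: gap; rewrite E2L; set K := (X in 2 * L * X) => gap.
have quad : L / 2 * s ^+ 2 - (Y - b) * s + K <= 0.
  move: inv'; rewrite hlo /h /K /s; lra.
have : 2 * L * (L / 2 * s ^+ 2 - (Y - b) * s + K) <= 0.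
  by rewrite pmulr_rle0// mulr_gt0.
have := sqr_ge0 (L * s - (Y - b)); lra.
Qed.

(** * Contraction in one coordinate *)

(** The point of Nesterov's estimate sequence that belongs to the iterate x and
    its extrapolation y: y is the average of x and this point with weights
    1 / (1 + a) and a / (1 + a). *)
Definition estimate (R : realType) (a x y : R) : R := ((1 + a) * y - x) / a.

(** The terms before c combine, with weights 1 - a and a, the model inequalities
    at the previous iterate x and at the minimizer z. With d = y - z and u the
    offset of the estimate point from y, the difference of the sides is c times
    the sum of a nonnegative multiple of a square and
      th a (1 + a) d^2 + (a + a^2) u^2
        - a th / 8 * (2 d^2 + 2 (1 - a) d u + (1 + a^2) u^2).
    The equal weights of both distances make the first coefficient nonnegative
    for every th >= 0; with the distance of the estimate point alone it would be
    nonnegative only for th = 1. *)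
Lemma contraction_coord (R : realType) (a th L x x' y y' z c : R) :
  0 < a <= 1 -> 0 <= th <= 1 -> 0 <= L ->
  y' = x' + (1 - a) / (1 + a) * (x' - x) ->
  c = L * a ^+ 2 / (2 * (1 + a)) ->
  - ((1 - a) * (L * (y - x') * (x - x') - L / 2 * (y - x') ^+ 2)) -
    a * (L * (y - x') * (z - x') - L / 2 * (y - x') ^+ 2
         + th * (L * a ^+ 2) / 2 * (z - y) ^+ 2) +
    c * ((estimate a x' y' - z) ^+ 2 + (x' - z) ^+ 2) <=
  (1 - a * th / 8) * (c * ((estimate a x y - z) ^+ 2 + (x - z) ^+ 2)).
Proof.
move=> /andP[a0 a1] /andP[th0 th1] L0 dy' dc.
pose u := estimate a x y - y; pose d := y - z.
pose w := estimate a x' y'.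
have Ha : a != 0 by rewrite gt_eqF.
have Ha1 : 1 + a != 0 by rewrite gt_eqF//; lra.
rewrite -subr_ge0.
rewrite [X in 0 <= X](_ : _ = c * (a * (1 - a) * (x - w) ^+ 2 +
  (th * a * (1 + a) * d ^+ 2 + (a + a ^+ 2) * u ^+ 2 -
   a * th / 8 * (2 * d ^+ 2 + 2 * (1 - a) * (d * u) + (1 + a ^+ 2) * u ^+ 2)))); last first.
  rewrite dc /w /d /u dy' /estimate; field; by rewrite Ha1 Ha.
have c0 : 0 <= c by rewrite dc; apply: divr_ge0; [rewrite mulr_ge0 ?sqr_ge0|lra].
apply: mulr_ge0 => //; apply: addr_ge0.
  by apply: mulr_ge0; [apply: mulr_ge0; lra|exact: sqr_ge0].
have bnd : 2 * d ^+ 2 + 2 * (1 - a) * (d * u) + (1 + a ^+ 2) * u ^+ 2 <=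
    3 * d ^+ 2 + 3 * u ^+ 2.
  have : 0 <= (1 - a) * (d - u) ^+ 2 by apply: mulr_ge0; [lra|exact: sqr_ge0].
  have : 0 <= a * d ^+ 2 by apply: mulr_ge0; [exact: ltW|exact: sqr_ge0].
  have : 0 <= a * u ^+ 2 by apply: mulr_ge0; [exact: ltW|exact: sqr_ge0].
  have : 0 <= (1 - a ^+ 2) * u ^+ 2.
    by apply: mulr_ge0; [rewrite subr_ge0 expr_le1// ltW|exact: sqr_ge0].
  lra.
have : a * th / 8 * (2 * d ^+ 2 + 2 * (1 - a) * (d * u) + (1 + a ^+ 2) * u ^+ 2) <=
    a * th / 8 * (3 * d ^+ 2 + 3 * u ^+ 2).
  by apply: ler_wpM2l => //; apply: divr_ge0 => //; apply: mulr_ge0 => //; exact: ltW.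
have ath : 0 <= a * th by rewrite mulr_ge0// ltW.
have : 0 <= a * th * d ^+ 2 by apply: mulr_ge0 => //; exact: sqr_ge0.
have : 0 <= a * th * a * d ^+ 2.
  by apply: mulr_ge0; [apply: mulr_ge0 => //; exact: ltW|exact: sqr_ge0].
have : 0 <= a * (1 - th) * u ^+ 2.
  by apply: mulr_ge0; [apply: mulr_ge0; lra|exact: sqr_ge0].
have : 0 <= a * th * u ^+ 2 by apply: mulr_ge0 => //; exact: sqr_ge0.
have : 0 <= a ^+ 2 * u ^+ 2 by apply: mulr_ge0; exact: sqr_ge0.
lra.
Qed.

(** * The smoothed objective *)

Lemma sum_option (V : nmodType) (I : finType) (f : option I -> V) :
  \sum_k f k = f None + \sum_i f (Some i).
Proof.
rewrite (bigD1 None)//= (reindex_omap Some id) => [|[]//].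
by congr (_ + _); apply: eq_bigl => i; rewrite eqxx.
Qed.

Section SmoothedObjective.
Context {R : realType} {m n : nat}.
Variables (alpha : \bar R) (B : 'rV[R]_n) (v : 'M[R]_(n, m)) (delta : R).
Hypothesis alphaP : alpha = 1%E \/ alpha = +oo%E.
Hypothesis B_gt0 : forall i, 0 < B ord0 i.
Hypothesis v_ge0 : forall i j, 0 <= v i j.
Hypothesis v_row : forall i, row i v != 0.
Hypothesis delta_gt0 : 0 < delta.
Implicit Types (x y : 'rV[R]_m) (i : 'I_n) (j : 'I_m) (k : option 'I_m).

(** Money is the outside option; it has price 1. *)
Definition logprice x k : R := if k is Some j then x ord0 j else 0.

(** The value 0 or 1 of the inverse of alpha is the weight of money. *)
Definition weight x i k : R :=
  if k is Some j then
    if v i j == 0 then 0 else expR ((ln (v i j) - x ord0 j) / delta)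
  else alphaV alpha.

(** The fraction of the budget of buyer i that goes to k. *)
Definition share x i k : R := weight x i k / \sum_k' weight x i k'.

Definition spending x j : R := \sum_i B ord0 i * share x i (Some j).

Definition slope x j : R := expR (x ord0 j) - spending x j.

Lemma alphaV_01 : alphaV alpha = 0 \/ alphaV alpha = 1.
Proof.
by rewrite /alphaV; case: alphaP => ->; [right; rewrite inve1|left; rewrite invey].
Qed.

Lemma alphaV_ge0 : 0 <= alphaV alpha.
Proof. by case: alphaV_01 => ->. Qed.

Lemma log_bangE x i k : log_bang alpha v x i k =
  match k with
  | Some j => if v i j == 0 then -oo%E else (ln (v i j) - x ord0 j)%:E
  | None => if alphaV alpha == 0 then -oo%E else 0%E
  end.
Proof.
rewrite /log_bang; case: k => [j|]; rewrite [val0 _ _ _]/= [logprice0 _ _ _]/=.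
  have [->|v0] := eqVneq (v i j) 0; first by rewrite le0_lneNy ?lexx.
  have v_gt0 : 0 < v i j by rewrite lt_neqAle eq_sym v0 v_ge0.
  by rewrite lne_EFin.
rewrite lne1 /alphaV; case: alphaP => ->.
  by rewrite lne1 sube0 inve1 [fine _]/= oner_eq0.
by rewrite invey eqxx.
Qed.

Lemma weightE x i k :
  fine (expeR (log_bang alpha v x i k / delta%:E)%E) = weight x i k.
Proof.
have dV : (delta%:E^-1 = (delta^-1)%:E)%E by rewrite inver gt_eqF.
rewrite log_bangE dV /weight; case: k => [j|].
  case: ifP => _ //.
  by rewrite gt0_mulNye ?lte_fin ?invr_gt0.
case: alphaV_01 => ->; rewrite ?eqxx ?oner_eq0.
  by rewrite gt0_mulNye ?lte_fin ?invr_gt0.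
by rewrite mul0e expeR0.
Qed.

Lemma FdeltaE x : Fdelta alpha B v delta x =
  \sum_j expR (x ord0 j) + delta * \sum_i B ord0 i * ln (\sum_k weight x i k).
Proof.
rewrite /Fdelta; congr (_ + _ * _); apply: eq_bigr => i _; congr (_ * ln _).
by apply: eq_bigr => k _; rewrite weightE.
Qed.

Lemma weight_ge0 x i k : 0 <= weight x i k.
Proof.
rewrite /weight; case: k => [j|]; last exact: alphaV_ge0.
by case: ifP => // _; exact: expR_ge0.
Qed.

Lemma exists_valued i : exists j, 0 < v i j.
Proof.
have [j vij|H] := pickP (fun j => 0 < v i j); first by exists j.
case/eqP: (v_row i); apply/rowP => j; rewrite !mxE.
by apply/eqP; rewrite eq_le v_ge0 andbT leNgt H.
Qed.

Lemma sum_weight_gt0 x i : 0 < \sum_k weight x i k.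
Proof.
have [j vij] := exists_valued i.
rewrite (bigD1 (Some j))//= ltr_pwDl ?sumr_ge0// => [|k _]; last exact: weight_ge0.
by rewrite gt_eqF ?expR_gt0.
Qed.

Lemma share_ge0 x i k : 0 <= share x i k.
Proof. by rewrite divr_ge0 ?weight_ge0// ltW// sum_weight_gt0. Qed.

Lemma sum_share x i : \sum_k share x i k = 1.
Proof. by rewrite -mulr_suml divff// gt_eqF// sum_weight_gt0. Qed.

Lemma weight_shift x y i k :
  weight x i k = weight y i k * expR ((logprice y k - logprice x k) / delta).
Proof.
rewrite /weight; case: k => [j|] /=; last by rewrite subrr mul0r expR0 mulr1.
case: ifP => _; first by rewrite mul0r.
by rewrite -expRD; congr expR; field; rewrite gt_eqF.
Qed.

Lemma ln_sum_weight_sub x y i :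
  ln (\sum_k weight x i k) - ln (\sum_k weight y i k) =
  ln (\sum_k share y i k * expR ((logprice y k - logprice x k) / delta)).
Proof.
rewrite -ln_div ?posrE ?sum_weight_gt0//; congr ln.
rewrite mulr_suml; apply: eq_bigr => k _.
by rewrite (weight_shift x y) /share; ring.
Qed.

Lemma spending_ge0 x j : 0 <= spending x j.
Proof. by apply: sumr_ge0 => i _; rewrite mulr_ge0 ?share_ge0// ltW. Qed.

Lemma norm1B : norm1 B = \sum_i B ord0 i.
Proof. by apply: eq_bigr => i _; rewrite gtr0_norm. Qed.

Lemma share_le1 x i k : share x i k <= 1.
Proof.
rewrite -(sum_share x i) (bigD1 k)//= lerDl sumr_ge0// => k' _.
exact: share_ge0.
Qed.

Lemma spending_le x j : spending x j <= norm1 B.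
Proof.
rewrite norm1B; apply: ler_sum => i _.
by rewrite ler_piMr ?share_le1// ltW.
Qed.

Lemma linear_share x y i :
  \sum_k share y i k * ((logprice y k - logprice x k) / delta) =
  - delta^-1 * \sum_j share y i (Some j) * (x ord0 j - y ord0 j).
Proof.
rewrite sum_option/= subrr mul0r mulr0 add0r mulr_sumr.
by apply: eq_bigr => j _; field; rewrite gt_eqF.
Qed.

Lemma sum_spending x y :
  \sum_i B ord0 i * (\sum_j share y i (Some j) * (x ord0 j - y ord0 j)) =
  \sum_j spending y j * (x ord0 j - y ord0 j).
Proof.
under eq_bigr do rewrite mulr_sumr.
rewrite exchange_big/=; apply: eq_bigr => j _; rewrite mulr_suml.
by apply: eq_bigr => i _; rewrite mulrA.
Qed.

(** The remainder of the log-sum-exp term is that of a tilted average with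
    weights [share y i], to which [ln_sum_expR_ge] and [ln_sum_expR_le]
    apply. *)
Lemma Fdelta_bregman x y :
  Fdelta alpha B v delta x - Fdelta alpha B v delta y -
    \sum_j slope y j * (x ord0 j - y ord0 j) =
  \sum_j (expR (x ord0 j) - expR (y ord0 j) -
          expR (y ord0 j) * (x ord0 j - y ord0 j)) +
  delta * \sum_i B ord0 i *
   (ln (\sum_k share y i k * expR ((logprice y k - logprice x k) / delta)) -
    \sum_k share y i k * ((logprice y k - logprice x k) / delta)).
Proof.
rewrite !FdeltaE.
have -> : \sum_j slope y j * (x ord0 j - y ord0 j) =
   \sum_j expR (y ord0 j) * (x ord0 j - y ord0 j) -
   \sum_j spending y j * (x ord0 j - y ord0 j).
  by rewrite -sumrB; apply: eq_bigr => j _; rewrite mulrBl.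
have -> : \sum_i B ord0 i *
   (ln (\sum_k share y i k * expR ((logprice y k - logprice x k) / delta)) -
    \sum_k share y i k * ((logprice y k - logprice x k) / delta)) =
  \sum_i B ord0 i * ln (\sum_k weight x i k) -
  \sum_i B ord0 i * ln (\sum_k weight y i k) +
  delta^-1 * \sum_j spending y j * (x ord0 j - y ord0 j).
  rewrite -sum_spending mulr_sumr -sumrB -big_split/=; apply: eq_bigr => i _.
  by rewrite -ln_sum_weight_sub linear_share; ring.
rewrite !sumrB; field.
by rewrite gt_eqF.
Qed.

Lemma Fdelta_ge x y c :
  (forall j, c <= expR (x ord0 j)) -> (forall j, c <= expR (y ord0 j)) ->
  Fdelta alpha B v delta y + \sum_j slope y j * (x ord0 j - y ord0 j) +
    c / 2 * \sum_j (x ord0 j - y ord0 j) ^+ 2 <= Fdelta alpha B v delta x.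
Proof.
move=> cx cy; rewrite -lerBrDl.
rewrite (_ : _ - _ = Fdelta alpha B v delta x - Fdelta alpha B v delta y -
  \sum_j slope y j * (x ord0 j - y ord0 j)); last by ring.
rewrite Fdelta_bregman -[leLHS]addr0; apply: lerD.
  by rewrite mulr_sumr; apply: ler_sum => j _; exact: expR_bregman_ge.
apply: mulr_ge0; first exact: ltW.
apply: sumr_ge0 => i _; apply: mulr_ge0; first exact: ltW.
by rewrite subr_ge0 ln_sum_expR_ge ?sum_share// => k; exact: share_ge0.
Qed.

Lemma Fdelta_ge_tangent x y :
  Fdelta alpha B v delta y + \sum_j slope y j * (x ord0 j - y ord0 j) <=
  Fdelta alpha B v delta x.
Proof.
have := @Fdelta_ge x y 0 (fun j => expR_ge0 _) (fun j => expR_ge0 _).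
by rewrite !mul0r addr0.
Qed.

Lemma Fdelta_le x y M :
  (forall j, expR (x ord0 j) <= M) -> (forall j, expR (y ord0 j) <= M) ->
  Fdelta alpha B v delta x <=
  Fdelta alpha B v delta y + \sum_j slope y j * (x ord0 j - y ord0 j) +
    (M + norm1 B / delta / 2) / 2 * \sum_j (x ord0 j - y ord0 j) ^+ 2.
Proof.
move=> xM yM; rewrite -lerBlDl.
rewrite (_ : _ - _ = Fdelta alpha B v delta x - Fdelta alpha B v delta y -
  \sum_j slope y j * (x ord0 j - y ord0 j)); last by ring.
rewrite Fdelta_bregman mulrDl mulrDl; apply: lerD.
  by rewrite mulr_sumr; apply: ler_sum => j _; exact: expR_bregman_le.
have bnd i : ln (\sum_k share y i k * expR ((logprice y k - logprice x k) / delta))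
    - \sum_k share y i k * ((logprice y k - logprice x k) / delta) <=
    4^-1 * delta ^- 2 * \sum_j (x ord0 j - y ord0 j) ^+ 2.
  rewrite lerBlDl; apply: le_trans.
    by apply: ln_sum_expR_le; [move=> k; exact: share_ge0|exact: sum_share].
  rewrite lerD2l sum_option/= subrr mul0r expr0n add0r -mulrA ler_wpM2l//.
  rewrite mulr_sumr; apply: ler_sum => j _.
  by rewrite le_eqVlt; apply/predU1P; left; field; rewrite gt_eqF.
apply: (@le_trans _ _ (delta * \sum_i B ord0 i *
    (4^-1 * delta ^- 2 * \sum_j (x ord0 j - y ord0 j) ^+ 2))).
  rewrite ler_pM2l//; apply: ler_sum => i _.
  by rewrite ler_wpM2l ?bnd// ltW.
rewrite -mulr_suml -norm1B; rewrite le_eqVlt; apply/predU1P; left.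
by field; rewrite gt_eqF.
Qed.

End SmoothedObjective.

(** * Gradient and constrained minimizer *)

(** A quadratic remainder bound along one line determines the directional
    derivative, so that differentiability in several variables is avoided. *)
Lemma derive_of_quadratic_remainder (R : realType) (V : normedModType R)
    (f : V -> R^o) (x d : V) (s C : R) :
  (forall h : R, `|h| <= 1 ->
     `|f (h *: d + x) - f x - h * s| <= C * h ^+ 2) ->
  'D_d f x = s.
Proof.
move=> H; apply: cvg_lim => //.
apply/cvgrPdist_le => e e0; near=> h.
have h0 : h != 0 by near: h; exact: nbhs_dnbhs_neq.
rewrite /= /GRing.scale/=.
have -> : s - h^-1 * (f (h *: d + x) - f x) =
    - (h^-1 * (f (h *: d + x) - f x - h * s)) by field.
rewrite normrN normrM normfV ler_pdivrMl ?normr_gt0//.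
apply: le_trans (H _ _) _.
  near: h; apply: dnbhs0_le; exact: ltr01.
rewrite -real_normK ?num_real// expr2 mulrCA ler_wpM2l//.
apply: (@le_trans _ _ ((`|C| + 1) * `|h|)).
  by rewrite ler_wpM2r// (le_trans (ler_norm C))// lerDl.
rewrite -ler_pdivlMl; last by rewrite ltr_wpDl.
near: h; apply: dnbhs0_le.
by rewrite mulr_gt0 ?invr_gt0// ltr_wpDl.
Unshelve. all: by end_near. Qed.

Section SmoothedObjectiveAnalysis.
Context {R : realType} {m n : nat}.
Variables (alpha : \bar R) (B : 'rV[R]_n) (v : 'M[R]_(n, m)) (delta : R).
Hypothesis alphaP : alpha = 1%E \/ alpha = +oo%E.
Hypothesis B_gt0 : forall i, 0 < B ord0 i.
Hypothesis v_ge0 : forall i j, 0 <= v i j.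
Hypothesis v_row : forall i, row i v != 0.
Hypothesis delta_gt0 : 0 < delta.
Implicit Types (x y : 'rV[R]_m) (i : 'I_n) (j : 'I_m) (k : option 'I_m).

Lemma Fdelta_shift1_ge x j h :
  Fdelta alpha B v delta x + slope alpha B v delta x j * h <=
  Fdelta alpha B v delta (h *: delta_mx ord0 j + x).
Proof.
have := Fdelta_ge_tangent alphaP B_gt0 v_ge0 v_row delta_gt0
  (h *: delta_mx ord0 j + x) x.
apply: le_trans; rewrite lerD2l (bigD1 j)//= big1 => [|l lj].
  by rewrite !mxE !eqxx addr0 mulr1 addrK.
by rewrite !mxE eqxx (negbTE lj) mulr0 add0r subrr mulr0.
Qed.

Lemma Fdelta_shift1_le x j h M :
  (forall l, expR (x ord0 l) <= M) -> expR (x ord0 j + h) <= M ->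
  Fdelta alpha B v delta (h *: delta_mx ord0 j + x) <=
  Fdelta alpha B v delta x + slope alpha B v delta x j * h +
   (M + norm1 B / delta / 2) / 2 * h ^+ 2.
Proof.
move=> xM jM.
have E l : (h *: delta_mx ord0 j + x) ord0 l = (l == j)%:R * h + x ord0 l.
  by rewrite !mxE eqxx mulrC.
have hM l : expR ((h *: delta_mx ord0 j + x) ord0 l) <= M.
  by rewrite E; have [->|lj] := eqVneq l j; rewrite ?mul1r ?mul0r ?add0r// addrC.
have := Fdelta_le alphaP B_gt0 v_ge0 v_row delta_gt0 hM xM.
move=> /le_trans; apply.
rewrite (bigD1 j)//= [X in _ + X + _]addrC big1 => [|l lj]; last first.
  by rewrite E (negbTE lj) mul0r add0r subrr mulr0.
rewrite add0r E eqxx mul1r addrK lerD2l.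
rewrite (bigD1 j)//= big1 => [|l lj]; last first.
  by rewrite E (negbTE lj) mul0r add0r subrr expr0n.
by rewrite addr0 E eqxx mul1r addrK.
Qed.

Lemma gradE x : grad (Fdelta alpha B v delta) x =
  \row_j slope alpha B v delta x j.
Proof.
apply/rowP => j; rewrite !mxE.
pose M := \sum_l expR (x ord0 l + 1).
have xM l h : h <= 1 -> expR (x ord0 l + h) <= M.
  move=> h1; apply: (@le_trans _ _ (expR (x ord0 l + 1))).
    by rewrite ler_expR lerD2l.
  by rewrite /M (bigD1 l)//= lerDl sumr_ge0// => ? _; exact: expR_ge0.
apply: (@derive_of_quadratic_remainder _ _ _ _ _ _
  ((M + norm1 B / delta / 2) / 2)) => h h1.
rewrite ger0_norm; last first.
  by have := Fdelta_shift1_ge x j h; lra.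
have hle : h <= 1 by apply: le_trans h1; exact: ler_norm.
have x0M l : expR (x ord0 l) <= M by rewrite -[x _ _]addr0; exact: xM.
have := Fdelta_shift1_le x0M (xM j h hle); lra.
Qed.

Lemma continuous_Fdelta : continuous (Fdelta alpha B v delta : 'rV[R]_m -> R).
Proof.
have -> : Fdelta alpha B v delta = fun x : 'rV[R]_m => \sum_j expR (x ord0 j) +
    delta * \sum_i B ord0 i * ln (\sum_k weight alpha v delta x i k).
  by apply/funext => x; rewrite FdeltaE.
have cont_sum (I : finType) (f : I -> 'rV[R]_m -> R) :
    (forall a, continuous (f a)) -> continuous (fun x => \sum_a f a x).
  by move=> cf; apply: continuous_big => //; exact: add_continuous.
have cC c : continuous (fun _ : 'rV[R]_m => c : R) by exact: cst_continuous.
have cD (f g : 'rV[R]_m -> R) : continuous f -> continuous g ->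
    continuous (fun x => f x + g x).
  by move=> cf cg x; exact: (continuousD (cf x) (cg x)).
have cM (f g : 'rV[R]_m -> R) : continuous f -> continuous g ->
    continuous (fun x => f x * g x).
  by move=> cf cg x; exact: (continuousM (cf x) (cg x)).
have coord j : continuous (fun x : 'rV[R]_m => x ord0 j).
  exact: coord_continuous.
have cw i k : continuous (fun x : 'rV[R]_m => weight alpha v delta x i k).
  rewrite /weight; case: k => [j|]; last exact: cst_continuous.
  case: (v i j == 0); first exact: cst_continuous.
  have : continuous (fun x => (ln (v i j) - x ord0 j) / delta); last first.
    by move=> cf x; apply: continuous_comp; [exact: cf|exact: continuous_expR].
  apply: cM (cC _); apply: cD (cC _) _.
  by move=> x; exact: (continuousN (@coord j x)).
apply: (cD (fun x => \sum_j expR (x ord0 j)) (fun x => delta * _)).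
  apply: cont_sum => j x.
  by apply: continuous_comp; [exact: coord|exact: continuous_expR].
apply: (cM (fun=> delta)); first exact: cC.
apply: (cont_sum _ _) => i; apply: (cM (fun=> B ord0 i)); first exact: cC.
have cS : continuous (fun x => \sum_k weight alpha v delta x i k).
  by apply: cont_sum => k; exact: cw.
move=> x; apply: continuous_comp; first exact: cS.
by apply: continuous_ln; exact: sum_weight_gt0.
Qed.

Lemma Fdelta_box_minimizer (lo hi : R) : lo <= hi ->
  exists xs : 'rV[R]_m, (forall j, lo <= xs ord0 j <= hi) /\
  forall x, (forall j, lo <= x ord0 j <= hi) ->
    Fdelta alpha B v delta xs <= Fdelta alpha B v delta x.
Proof.
move=> lohi.
pose A : set 'rV[R]_m := [set x | forall j, `[lo, hi]%classic (x ord0 j)].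
have AP x : A x <-> forall j, lo <= x ord0 j <= hi.
  by split=> H j; have := H j; rewrite /= in_itv.
have [||| xs /set_mem xsA xs_min] := @EVT_min_rV R m (Fdelta alpha B v delta) A.
- by exists (const_mx lo); apply/AP => j; rewrite mxE lexx.
- exact: (@rV_compact _ m (fun=> `[lo, hi]%classic) (fun=> @segment_compact R _ _)).
- by apply: continuous_subspaceT; exact: continuous_Fdelta.
exists xs; split; first exact/AP.
by move=> x xA; apply: xs_min; apply/mem_set/AP.
Qed.

(** Otherwise a short move along coordinate j would decrease the objective: the
    remainder in [Fdelta_shift1_le] is quadratic in the length of the move. *)
Lemma box_minimizer_slope (lo hi : R) (xs : 'rV[R]_m) :
  (forall j, lo <= xs ord0 j <= hi) ->
  (forall x, (forall j, lo <= x ord0 j <= hi) ->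
    Fdelta alpha B v delta xs <= Fdelta alpha B v delta x) ->
  forall j, (xs ord0 j < hi -> 0 <= slope alpha B v delta xs j) /\
            (lo < xs ord0 j -> slope alpha B v delta xs j <= 0).
Proof.
move=> box xs_min j.
pose M := \sum_l expR (xs ord0 l + 1).
have xM l h : h <= 1 -> expR (xs ord0 l + h) <= M.
  move=> h1; apply: (@le_trans _ _ (expR (xs ord0 l + 1))).
    by rewrite ler_expR lerD2l.
  by rewrite /M (bigD1 l)//= lerDl sumr_ge0// => ? _; exact: expR_ge0.
have M0 : 0 <= M by apply: sumr_ge0 => l _; exact: expR_ge0.
set C := (M + norm1 B / delta / 2) / 2.
have C0 : 0 <= C.
  have B0 : 0 <= norm1 B by apply: sumr_ge0 => i _; exact: normr_ge0.
  by rewrite divr_ge0// addr_ge0// !divr_ge0// ltW.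
have step h : h <= 1 -> lo <= xs ord0 j + h <= hi ->
    0 <= slope alpha B v delta xs j * h + C * h ^+ 2.
  move=> h1 hbox.
  have H : forall l, expR (xs ord0 l) <= M.
    by move=> l; rewrite -[xs _ _]addr0; exact: xM.
  have := Fdelta_shift1_le H (xM j h h1).
  have : Fdelta alpha B v delta xs <=
      Fdelta alpha B v delta (h *: delta_mx ord0 j + xs).
    apply: xs_min => l; rewrite !mxE eqxx /=.
    have [->|lj] := eqVneq l j; first by rewrite mulr1 addrC.
    by rewrite mulr0 add0r.
  rewrite -/C; lra.
have key (s t : R) : 0 < t -> (forall h, 0 < h <= t -> 0 <= s * h + C * h ^+ 2) ->
    0 <= s.
  move=> t0 H; rewrite leNgt; apply/negP => s0.
  pose h := Num.min t (- s / (2 * (C + 1))).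
  have h0 : 0 < h by rewrite lt_min t0 divr_gt0//; lra.
  have hs : h * (2 * (C + 1)) <= - s.
    by rewrite -ler_pdivlMr ?ge_min ?lexx ?orbT//; lra.
  have := H h; rewrite h0 ge_min lexx => /(_ isT).
  have : h * (h * (2 * (C + 1))) <= h * - s by rewrite ler_wpM2l// ltW.
  have : 0 < h * h by rewrite mulr_gt0.
  have : 0 <= C * (h * h) by rewrite mulr_ge0// mulr_ge0// ltW.
  have : 0 < h * - s by rewrite mulr_gt0//; lra.
  lra.
have /andP[lox xhi] := box j.
split=> hj.
  apply: (key _ (Num.min 1 (hi - xs ord0 j))).
    by rewrite lt_min ltr01 subr_gt0.
  move=> h /andP[h0]; rewrite le_min => /andP[h1 h2].
  by apply: step => //; apply/andP; split; lra.
rewrite -oppr_ge0; apply: (key _ (xs ord0 j - lo)); first by rewrite subr_gt0.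
move=> h /andP[h0 h1].
have := step (- h); rewrite mulrN sqrrN mulNr; apply; first lra.
by apply/andP; split; lra.
Qed.

End SmoothedObjectiveAnalysis.

(** * The minimizer of a market *)

Section FiniteExtrema.
Context {R : realType} {I : finType}.
Implicit Types (f : I -> R) (i : I).

Lemma fmax_attained f i0 : exists i, fmax f = f i /\ forall i', f i' <= f i.
Proof.
have [i _ imax] := @arg_maxP _ _ I i0 xpredT f isT.
exists i; split=> [|i']; last exact: imax.
apply/eqP; rewrite eq_le; apply/andP; split.
  by apply: ge_sup; [exists (f i0), i0|move=> _ [i' _ <-]; exact: imax].
by apply: ub_le_sup; [exists (f i) => _ [i' _ <-]; exact: imax|exists i].
Qed.

Lemma fmin_attained f i0 : exists i, fmin f = f i /\ forall i', f i <= f i'.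
Proof.
have [i _ imin] := @arg_minP _ _ I i0 xpredT f isT.
exists i; split=> [|i']; last exact: imin.
apply/eqP; rewrite eq_le; apply/andP; split.
  by apply: ge_inf; [exists (f i) => _ [i' _ <-]; exact: imin|exists i].
by apply: lb_le_inf; [exists (f i0), i0|move=> _ [i' _ <-]; exact: imin].
Qed.

End FiniteExtrema.

Section MarketBounds.
Context {R : realType} {m n : nat}.
Variables (alpha : \bar R) (B : 'rV[R]_n) (v : 'M[R]_(n, m)).
Hypothesis m_ge1 : (1 <= m)%N.
Hypothesis n_ge1 : (1 <= n)%N.
Hypothesis alphaP : alpha = 1%E \/ alpha = +oo%E.
Hypothesis B_gt0 : forall i, 0 < B ord0 i.
Hypothesis v_ge0 : forall i j, 0 <= v i j.
Hypothesis v_row : forall i, row i v != 0.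
Hypothesis v_col : forall j, col j v != 0.
Implicit Types (x y : 'rV[R]_m) (i : 'I_n) (j : 'I_m).

Let p := punder alpha B v.
Let P := pbar alpha B v.

Lemma norm1_row i : norm1 (row i v) = \sum_j v i j.
Proof. by apply: eq_bigr => j _; rewrite mxE ger0_norm. Qed.

Lemma norm1_row_gt0 i : 0 < norm1 (row i v).
Proof.
have [j vij] := exists_valued v_ge0 v_row i.
rewrite norm1_row (bigD1 j)//= ltr_pwDl// sumr_ge0//.
Qed.

Lemma norm1B_gt0 : 0 < norm1 B.
Proof.
rewrite (norm1B B_gt0) (bigD1 (Ordinal n_ge1))//= ltr_pwDl// sumr_ge0// => i _.
exact: ltW.
Qed.

Lemma denominator_gt0 i : 0 < norm1 (row i v) + alphaV alpha * B ord0 i.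
Proof.
by rewrite ltr_pwDl ?norm1_row_gt0// mulr_ge0 ?(alphaV_ge0 alphaP)// ltW.
Qed.

Lemma punder_gt0 : 0 < p.
Proof.
rewrite /p /punder; set g := fun j : 'I_m => _.
have [j [-> _]] := fmin_attained g (Ordinal m_ge1).
have [i [gE gmax]] := fmax_attained (fun i : 'I_n =>
    v i j * B ord0 i / (norm1 (row i v) + alphaV alpha * B ord0 i)) (Ordinal n_ge1).
rewrite /g gE.
have [i' vi'j] : exists i', 0 < v i' j.
  have [i' vi'j|H] := pickP (fun i => 0 < v i j); first by exists i'.
  case/eqP: (v_col j); apply/colP => i'; rewrite !mxE.
  by apply/eqP; rewrite eq_le v_ge0 andbT leNgt H.
apply: lt_le_trans (gmax i').
by rewrite divr_gt0 ?denominator_gt0// mulr_gt0.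
Qed.

Lemma punder_buyer j : exists i,
  p * (norm1 (row i v) + alphaV alpha * B ord0 i) <= v i j * B ord0 i.
Proof.
rewrite /p /punder; set g := fun j : 'I_m => _.
have [j0 [-> /(_ j) gmin]] := fmin_attained g (Ordinal m_ge1).
have [i [gE _]] := fmax_attained (fun i : 'I_n =>
    v i j * B ord0 i / (norm1 (row i v) + alphaV alpha * B ord0 i)) (Ordinal n_ge1).
exists i; rewrite -ler_pdivlMr ?denominator_gt0//.
by apply: (le_trans gmin); rewrite /g gE.
Qed.

Lemma value_le_norm1 i j : v i j <= norm1 (row i v).
Proof. by rewrite norm1_row (bigD1 j)//= lerDl sumr_ge0. Qed.

Lemma punder_le_norm1B : p <= norm1 B.
Proof.
have [i hi] := punder_buyer (Ordinal m_ge1).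
apply: (@le_trans _ _ (B ord0 i)); last first.
  rewrite (norm1B B_gt0) (bigD1 i)//= lerDl sumr_ge0// => ? _; exact: ltW.
have Ni := norm1_row_gt0 i.
rewrite -(ler_pM2r Ni); have := punder_gt0.
have := value_le_norm1 i (Ordinal m_ge1).
have := alphaV_ge0 alphaP; have Bi := B_gt0 i => a0 vN p0.
have : v i (Ordinal m_ge1) * B ord0 i <= norm1 (row i v) * B ord0 i.
  by rewrite ler_wpM2r// ltW.
have : 0 <= p * (alphaV alpha * B ord0 i).
  by rewrite mulr_ge0 ?mulr_ge0// ltW.
lra.
Qed.

Lemma punder_le_value i j : alphaV alpha = 1 ->
  p * (norm1 (row i v) + alphaV alpha * B ord0 i) <= v i j * B ord0 i ->
  p <= v i j.
Proof.
move=> -> hi; have Bi := B_gt0 i; rewrite -(ler_pM2r Bi).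
have : 0 <= p * norm1 (row i v) by rewrite mulr_ge0 ?ltW ?punder_gt0 ?norm1_row_gt0.
lra.
Qed.

Lemma pbarE : (alphaV alpha = 0 /\ P = norm1 B) \/
  (alphaV alpha = 1 /\ forall i j, v i j <= P).
Proof.
rewrite /P /pbar.
have [[i j] [fE fm]] := fmax_attained
  (fun ij : 'I_n * 'I_m => alphaV alpha * v ij.1 ij.2)
  (Ordinal n_ge1, Ordinal m_ge1).
case: (alphaV_01 alphaP) => aE; [left|right]; split => //.
  by rewrite fE aE mul0r subr0 mul1r addr0.
by move=> i' j'; have := fm (i', j'); rewrite fE aE !mul1r subrr mul0r add0r.
Qed.

Lemma punder_le_pbar : p <= P.
Proof.
have [[_ ->]|[a1 vP]] := pbarE; first exact: punder_le_norm1B.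
have [i hi] := punder_buyer (Ordinal m_ge1).
by apply: le_trans (vP i (Ordinal m_ge1)); exact: punder_le_value hi.
Qed.

Lemma pbar_gt0 : 0 < P.
Proof. exact: lt_le_trans punder_gt0 punder_le_pbar. Qed.

Variable delta : R.
Hypothesis delta_gt0 : 0 < delta.
Hypothesis delta_small : norm1 B * delta <= p.

Let lo := muunder alpha B v - 1.
Let hi := mubar alpha B v + 1.

Local Notation slope_ := (slope alpha B v delta).
Local Notation share_ := (share alpha v delta).
Local Notation spending_ := (spending alpha B v delta).
Local Notation weight_ := (weight alpha v delta).

Lemma expR_lo : expR lo = p / expR 1.
Proof. by rewrite expRB lnK// posrE; exact: punder_gt0. Qed.

Lemma expR_hi : expR hi = P * expR 1.
Proof. by rewrite expRD lnK// posrE; exact: pbar_gt0. Qed.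

Lemma lo_lt_hi : lo < hi.
Proof.
have : muunder alpha B v <= mubar alpha B v.
  by rewrite ler_ln ?posrE ?punder_gt0 ?pbar_gt0//; exact: punder_le_pbar.
rewrite /lo /hi; lra.
Qed.

Lemma delta_le1 : delta <= 1.
Proof.
rewrite -(ler_pM2l norm1B_gt0 delta) mulr1; apply: le_trans delta_small _.
exact: punder_le_norm1B.
Qed.

(** With linear utilities the price e * |B|_1 exceeds all the money in the
    market. With quasi-linear utilities the price e * max v makes money at least
    exp(1 / delta) times as attractive as the good, so that spending on it is at
    most |B|_1 exp(- 1 / delta) <= |B|_1 delta. *)
Lemma slope_hi_gt0 x j : x ord0 j = hi -> 0 < slope_ x j.
Proof.
move=> xj; rewrite /slope xj expR_hi subr_gt0.
have P0 := pbar_gt0; have E := @expR1_ge R.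
apply: (@le_lt_trans _ _ P); last by rewrite ltr_pMr//; lra.
have [[_ ->]|[a1 vP]] := pbarE.
  exact: spending_le.
apply: le_trans (_ : norm1 B * delta <= _); last first.
  exact: le_trans delta_small punder_le_pbar.
rewrite (norm1B B_gt0) mulr_suml; apply: ler_sum => i _.
apply: ler_wpM2l; first exact: ltW.
have W0 := sum_weight_gt0 delta alphaP v_ge0 v_row x i.
rewrite /share ler_pdivrMr//.
have W1 : 1 <= \sum_k weight_ x i k.
  by rewrite sum_option {1}/weight a1 lerDl sumr_ge0// => k _; exact: weight_ge0.
apply: (@le_trans _ _ delta); last by rewrite ler_peMr// ltW.
rewrite /weight; case: ifPn => [_|v0]; first exact: ltW.
have vij : 0 < v i j by rewrite lt_neqAle eq_sym v0 v_ge0.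
have lnv : ln (v i j) <= mubar alpha B v by rewrite ler_ln ?posrE//; exact: vP.
apply: (@le_trans _ _ (expR (- delta^-1))).
  rewrite ler_expR xj ler_pdivrMr// mulNr mulVf ?gt_eqF// /hi; lra.
rewrite expRN invf_ple ?posrE ?expR_gt0//.
by apply: le_trans (expR_ge1Dx _); rewrite lerDr.
Qed.

(** Let the price q of good j be the lowest price, exp(lo) < punder, and let
    buyer i attain the maximum for j in the definition of punder. An option that
    is more attractive than j for i costs at most v_ik * q / v_ij and, as
    spending does not exceed price, receives at most that from i; a less
    attractive option receives less than j by the corresponding factor, which
    leads to the same bound because its price is at least q. Summed over all
    options, the budget of i is at most
    (|v_i|_1 + B_i / alpha) * q / v_ij < B_i. *)
Lemma box_minimizer_gt_lo x :
  (forall j, lo <= x ord0 j) -> (forall j, 0 <= slope_ x j) ->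
  forall j, lo < x ord0 j.
Proof.
move=> xlo xs j; rewrite lt_neqAle xlo andbT; apply/eqP => xj.
have p0 := punder_gt0; have E := @expR1_ge R.
have [i hi_] := punder_buyer j.
have Bi := B_gt0 i.
have c0 := denominator_gt0 i; set c := (X in p * X <= _) in hi_ c0 *.
have vij : 0 < v i j.
  rewrite -(pmulr_lgt0 _ Bi); apply: lt_le_trans hi_; exact: mulr_gt0.
set q := expR lo; have q0 : 0 < q := expR_gt0 _.
have qp : q < p.
  by rewrite /q expR_lo ltr_pdivrMr ?expR_gt0// ltr_pMr//; lra.
have paid k : B ord0 i * share_ x i (Some k) <= expR (x ord0 k).
  apply: le_trans (_ : spending_ x k <= _); last by have := xs k; rewrite subr_ge0.
  rewrite /spending (bigD1 i)//= lerDl sumr_ge0// => i' _.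
  by rewrite mulr_ge0 ?(share_ge0 delta alphaP v_ge0 v_row)// ltW.
have W0 := sum_weight_gt0 delta alphaP v_ge0 v_row x i.
have wj : weight_ x i (Some j) = expR ((ln (v i j) - lo) / delta).
  by rewrite /= gt_eqF// -xj.
(* An option whose bang per buck is lower by the factor exp(t) receives at most
   exp(t) times the money, because 1 <= 1 / delta. *)
have less t : t <= 0 ->
    expR ((ln (v i j) - lo + t) / delta) / (\sum_k weight_ x i k) <=
    share_ x i (Some j) * expR t.
  move=> t0; rewrite mulrDl expRD -wj mulrAC ler_wpM2l//.
    exact: share_ge0.
  rewrite ler_expR ler_pdivrMr// -subr_ge0.
  rewrite (_ : _ - _ = - t * (1 - delta)); last by ring.
  by rewrite mulr_ge0 ?oppr_ge0 ?subr_ge0 ?delta_le1.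
have some_k k : B ord0 i * share_ x i (Some k) <= v i k * (q / v i j).
  have [vik0|vik0] := eqVneq (v i k) 0.
    by rewrite /share /= vik0 eqxx !mul0r mulr0.
  have vik : 0 < v i k by rewrite lt_neqAle eq_sym vik0 v_ge0.
  pose t := ln (v i k) - x ord0 k - (ln (v i j) - lo).
  have et : expR t = v i k * (q / v i j) / expR (x ord0 k).
    rewrite /t expRB (expRB (ln (v i k))) (expRB (ln (v i j))) !lnK ?posrE// -/q.
    by field; rewrite !gt_eqF ?expR_gt0.
  have xk0 := expR_gt0 (x ord0 k).
  have [t0|t0] := leP 0 t.
    apply: le_trans (paid k) _.
    have : 1 <= expR t by rewrite -expR0 ler_expR.
    by rewrite et ler_pdivlMr// mul1r.
  have := less t (ltW t0).
  rewrite (_ : ln (v i j) - lo + t = ln (v i k) - x ord0 k); last by rewrite /t; ring.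
  have -> : expR ((ln (v i k) - x ord0 k) / delta) = weight_ x i (Some k).
    by rewrite /= (negbTE vik0).
  move=> sh; apply: (@le_trans _ _ (B ord0 i * (share_ x i (Some j) * expR t))).
    by rewrite ler_pM2l.
  rewrite mulrA; apply: (@le_trans _ _ (q * expR t)).
    by rewrite ler_wpM2r ?expR_ge0//; have := paid j; rewrite -xj.
  rewrite et mulrA ler_pdivrMr// mulrC ler_wpM2l//.
    by rewrite mulr_ge0 ?divr_ge0// ltW.
  by rewrite ler_expR.
have none : B ord0 i * share_ x i None <= alphaV alpha * B ord0 i * (q / v i j).
  case: (alphaV_01 alphaP) => aE.
    by rewrite /share /= aE !mul0r mulr0.
  have pv := punder_le_value aE hi_.
  pose t := lo - ln (v i j).
  have et : expR t = q / v i j by rewrite /t expRB lnK ?posrE.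
  have t0 : t <= 0.
    rewrite -ler_expR expR0 et ler_pdivrMr// mul1r; apply: le_trans pv; exact: ltW.
  have := less t t0; rewrite (_ : _ + t = 0); last by rewrite /t; ring.
  rewrite mul0r expR0 et => sh.
  rewrite aE mul1r ler_pM2l// /share {1}/weight aE; apply: (le_trans sh).
  by rewrite ler_piMl ?(share_le1 delta alphaP v_ge0 v_row)// divr_ge0// ltW.
have : B ord0 i <= c * (q / v i j).
  rewrite -[leLHS]mulr1 -(sum_share delta alphaP v_ge0 v_row x i).
  rewrite mulr_sumr sum_option /c addrC mulrDl; apply: lerD; last exact: none.
  by rewrite norm1_row mulr_suml; apply: ler_sum => k _; exact: some_k.
rewrite mulrA ler_pdivlMr//.
have : c * q < c * p by rewrite ltr_pM2l.
lra.
Qed.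

Lemma Fdelta_minimizer : exists xs : 'rV[R]_m,
  (forall j, lo <= xs ord0 j <= hi) /\
  forall x, Fdelta alpha B v delta xs <= Fdelta alpha B v delta x.
Proof.
have [xs [box xs_min]] :=
  Fdelta_box_minimizer B alphaP v_ge0 v_row delta_gt0 (ltW lo_lt_hi).
have kkt := box_minimizer_slope alphaP B_gt0 v_ge0 v_row delta_gt0 box xs_min.
have lt_hi j : xs ord0 j < hi.
  have /andP[_ xj] := box j; rewrite lt_neqAle xj andbT; apply/eqP => xjE.
  have := slope_hi_gt0 xjE; have [_] := kkt j.
  rewrite xjE leNgt => H; apply/negP/H.
  exact: lo_lt_hi.
have slope_ge0 j : 0 <= slope_ xs j by have [] := kkt j; auto.
have gt_lo := box_minimizer_gt_lo (fun j => proj1 (andP (box j))) slope_ge0.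
have slope0 j : slope_ xs j = 0.
  by apply/eqP; rewrite eq_le slope_ge0 andbT; have [_] := kkt j; exact.
exists xs; split => // x.
have := Fdelta_ge_tangent alphaP B_gt0 v_ge0 v_row delta_gt0 x xs.
by rewrite big1 ?addr0// => j _; rewrite slope0 mul0r.
Qed.

End MarketBounds.

(** * Smoothing error *)

Section SmoothingError.
Context {R : realType} {m n : nat}.
Variables (alpha : \bar R) (B : 'rV[R]_n) (v : 'M[R]_(n, m)) (delta : R).
Hypothesis alphaP : alpha = 1%E \/ alpha = +oo%E.
Hypothesis B_gt0 : forall i, 0 < B ord0 i.
Hypothesis v_ge0 : forall i j, 0 <= v i j.
Hypothesis v_row : forall i, row i v != 0.
Hypothesis delta_gt0 : 0 < delta.
Implicit Types (x y : 'rV[R]_m) (i : 'I_n) (j : 'I_m) (k : option 'I_m).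

(** The sum of m + 1 weights is between its largest term and m + 1 times that
    term. *)
Lemma best_bangP x i : exists b : R,
  [/\ \big[maxe/-oo%E]_k log_bang alpha v x i k = b%:E,
      b <= delta * ln (\sum_k weight alpha v delta x i k) &
      delta * ln (\sum_k weight alpha v delta x i k) <=
        b + delta * ln m.+1%:R].
Proof.
have [k _ kmax] := @arg_maxP _ _ _ None xpredT (log_bang alpha v x i) isT.
have {}kmax k' : (log_bang alpha v x i k' <= log_bang alpha v x i k)%E.
  exact: kmax.
have big_k : \big[maxe/-oo%E]_k log_bang alpha v x i k = log_bang alpha v x i k.
  apply/eqP; rewrite eq_le le_bigmax andbT.
  by apply: bigmax_le => [|k' _]; [exact: leNye|exact: kmax].
have [j vij] := exists_valued v_ge0 v_row i.
have k_fin : exists b : R, log_bang alpha v x i k = b%:E.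
  have := kmax (Some j); rewrite !(log_bangE alphaP v_ge0).
  rewrite gt_eqF//; case: (k) => [j'|].
    case: (v i j' == 0); first by rewrite leNgt ltNyr.
    by move=> _; exists (ln (v i j') - x ord0 j').
  case: (alphaV alpha == 0); first by rewrite leNgt ltNyr.
  by move=> _; exists 0.
case: k_fin => b kb; exists b; rewrite big_k.
have weight_le k' : weight alpha v delta x i k' <= expR (b / delta).
  rewrite -(weightE alphaP v_ge0 delta_gt0).
  have := kmax k'; rewrite kb.
  have dV : (delta%:E^-1 = (delta^-1)%:E)%E by rewrite inver gt_eqF.
  rewrite dV; case: (log_bang alpha v x i k') => [r| |] //=.
    by rewrite lee_fin => rb; rewrite ler_expR ler_wpM2r// invr_ge0 ltW.
  by rewrite gt0_mulNye ?lte_fin ?invr_gt0//= expR_ge0.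
have weight_k : weight alpha v delta x i k = expR (b / delta).
  rewrite -(weightE alphaP v_ge0 delta_gt0) kb.
  by rewrite inver gt_eqF.
have W0 := sum_weight_gt0 delta alphaP v_ge0 v_row x i.
have expb : b = delta * ln (expR (b / delta)).
  by rewrite expRK mulrC divfK// gt_eqF.
split=> //.
  rewrite {1}expb ler_pM2l// ler_ln ?posrE ?expR_gt0// -weight_k.
  rewrite (bigD1 k)//= lerDl sumr_ge0// => k' _; exact: weight_ge0.
rewrite {1}expb -mulrDr ler_pM2l// -lnM ?posrE ?expR_gt0//.
rewrite ler_ln ?posrE ?mulr_gt0 ?expR_gt0//.
apply: (@le_trans _ _ (\sum_(k' : option 'I_m) expR (b / delta))).
  by apply: ler_sum => k' _; exact: weight_le.
by rewrite sumr_const card_option card_ord mulr_natr.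
Qed.

Lemma F_near_Fdelta x : exists f : R, [/\ F alpha B v x = f%:E,
  f <= Fdelta alpha B v delta x &
  Fdelta alpha B v delta x <= f + delta * norm1 B * ln m.+1%:R].
Proof.
have [b bP] := choice (best_bangP x).
exists (\sum_j expR (x ord0 j) + \sum_i B ord0 i * b i).
have FE : delta * \sum_i B ord0 i * ln (\sum_k weight alpha v delta x i k) =
    \sum_i B ord0 i * (delta * ln (\sum_k weight alpha v delta x i k)).
  by rewrite mulr_sumr; apply: eq_bigr => i _; ring.
split.
- rewrite /F EFinD; congr (_ + _)%E; rewrite -sumEFin; apply: eq_bigr => i _.
  by have [-> _ _] := bP i.
- rewrite (FdeltaE B alphaP v_ge0 delta_gt0) FE lerD2l; apply: ler_sum => i _.
  by rewrite ler_pM2l//; have [] := bP i.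
rewrite (FdeltaE B alphaP v_ge0 delta_gt0) FE -addrA lerD2l.
rewrite (norm1B B_gt0) mulr_sumr mulr_suml -big_split/=.
apply: ler_sum => i _.
rewrite (_ : _ + _ = B ord0 i * (b i + delta * ln m.+1%:R)); last by ring.
by rewrite ler_pM2l//; have [] := bP i.
Qed.

Lemma eps_CE_of_Fdelta_gap eps xs x :
  (forall y, Fdelta alpha B v delta xs <= Fdelta alpha B v delta y) ->
  Fdelta alpha B v delta x - Fdelta alpha B v delta xs <= eps / 2 ->
  delta * norm1 B * ln m.+1%:R <= eps / 2 ->
  eps_CE_price alpha B v eps (map_mx (@expR R) x).
Proof.
move=> xs_min gap smoothing; split=> [j|]; first by rewrite mxE expR_gt0.
have -> : map_mx (@ln R) (map_mx (@expR R) x) = x.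
  by apply/rowP => j; rewrite !mxE expRK.
have [f [-> fx _]] := F_near_Fdelta x.
have : ((f - eps)%:E <= ereal_inf (range (F alpha B v)))%E.
  apply: le_ereal_inf_tmp => _ [z _ <-].
  have [g [-> _ gz]] := F_near_Fdelta z.
  rewrite lee_fin; have := xs_min z; lra.
case: (ereal_inf _) => [r| |] //=.
  by rewrite -EFinB !lee_fin; lra.
by move=> _; rewrite leNye.
Qed.

End SmoothingError.

(** * Runs of the price adjustment *)

(** The variational inequality of the projection onto [lo, hi]. *)
Lemma clip_obtuse (R : realType) (lo hi L y g z x' : R) :
  0 < L -> lo <= z <= hi ->
  x' = Num.max lo (Num.min (y - L^-1 * g) hi) ->
  L * (y - x') * (z - x') <= g * (z - x').
Proof.
move=> L0 /andP[loz zhi] ex'.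
have ge : L * (y - L^-1 * g) = L * y - g.
  by rewrite mulrBr mulrA divff ?mul1r// gt_eqF.
suff : 0 <= L * (x' - (y - L^-1 * g)) * (z - x').
  have -> : L * (x' - (y - L^-1 * g)) = L * x' - (L * y - g) by rewrite mulrBr ge.
  lra.
rewrite ex'; have [h1|h1] := leP (y - L^-1 * g) hi.
  have [h2|h2] := leP lo (y - L^-1 * g); first by rewrite subrr mulr0 mul0r.
  by rewrite mulr_ge0 ?subr_ge0// mulr_ge0 ?subr_ge0// ltW.
have h2 : lo <= hi by rewrite (le_trans loz).
rewrite max_r// mulr_le0 ?subr_le0// pmulr_rle0// subr_le0 ltW//.
Qed.

Section Run.
Context {R : realType} {m n : nat}.
Variables (alpha : \bar R) (B : 'rV[R]_n) (v : 'M[R]_(n, m)) (eps : R).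
Hypothesis m_ge1 : (1 <= m)%N.
Hypothesis n_ge1 : (1 <= n)%N.
Hypothesis alphaP : alpha = 1%E \/ alpha = +oo%E.
Hypothesis B_gt0 : forall i, 0 < B ord0 i.
Hypothesis v_ge0 : forall i j, 0 <= v i j.
Hypothesis v_row : forall i, row i v != 0.
Hypothesis v_col : forall j, col j v != 0.
Hypothesis eps_gt0 : 0 < eps.
Hypothesis eps_le : eps <= expR (muunder alpha B v - 1).

Let p := punder alpha B v.
Let P := pbar alpha B v.
Let b := norm1 B.
Let lo := muunder alpha B v - 1.
Let hi := mubar alpha B v + 1.
Let w := hi - lo.
Let delta := @apm_delta R m n B eps.
Let Lam := b / delta.
Let L := apm_L alpha B v eps.
Let sigma := apm_sigma alpha B v.
Let a := Num.sqrt (apm_q alpha B v eps).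
Let theta := expR (- w).
Let lnm := ln m.+1%:R : R.

Local Notation Phi := (Fdelta alpha B v delta).
Local Notation slope_ := (slope alpha B v delta).
Local Notation next := (apm_step alpha B v eps).

Let p_gt0 : 0 < p := punder_gt0 m_ge1 n_ge1 alphaP B_gt0 v_ge0 v_row v_col.
Let P_gt0 : 0 < P := pbar_gt0 m_ge1 n_ge1 alphaP B_gt0 v_ge0 v_row v_col.
Let b_gt0 : 0 < b := norm1B_gt0 n_ge1 B_gt0.
Let p_le_P : p <= P := punder_le_pbar m_ge1 n_ge1 alphaP B_gt0 v_ge0 v_row v_col.
Let p_le_b : p <= b := punder_le_norm1B m_ge1 n_ge1 alphaP B_gt0 v_ge0 v_row v_col.

Lemma sigmaE : sigma = p / expR 1.
Proof. exact: (expR_lo m_ge1 n_ge1 alphaP B_gt0 v_ge0 v_row v_col). Qed.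

Lemma eps_le_sigma : eps <= sigma. Proof. exact: eps_le. Qed.

Lemma sigma_gt0 : 0 < sigma. Proof. exact: expR_gt0. Qed.

Lemma lnm_ge : 2 / 3 <= lnm.
Proof.
apply: (le_trans (@ln2_ge R)).
by rewrite ler_ln ?posrE ?ltr0n// ler_nat ltnS.
Qed.

Lemma lnm_gt0 : 0 < lnm.
Proof. by apply: lt_le_trans lnm_ge; rewrite divr_gt0. Qed.

Lemma apm_delta_gt0 : 0 < delta.
Proof. by rewrite /delta /apm_delta divr_gt0 ?mulr_gt0 ?lnm_gt0. Qed.

Lemma apm_smoothing : delta * b * lnm = eps / 2.
Proof.
rewrite /delta /apm_delta -/b -/lnm; field.
by rewrite !gt_eqF ?lnm_gt0.
Qed.

Lemma apm_delta_small : b * delta <= p.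
Proof.
have l := lnm_ge; have E := @expR1_ge R.
have : eps <= p.
  apply: (le_trans eps_le_sigma); rewrite sigmaE ler_pdivrMr ?expR_gt0//.
  by rewrite ler_peMr ?(ltW p_gt0)//; lra.
have := apm_smoothing; have := mulr_gt0 b_gt0 apm_delta_gt0.
rewrite (mulrC delta) => bd0 s ep.
have : b * delta * (2 / 3) <= b * delta * lnm by rewrite ler_wpM2l// ltW.
lra.
Qed.

Lemma LamE : Lam = 2 * lnm * b ^+ 2 / eps.
Proof.
rewrite /Lam /delta /apm_delta -/b -/lnm; field.
by rewrite !gt_eqF ?lnm_gt0.
Qed.

Lemma Lam_gt0 : 0 < Lam.
Proof. by rewrite divr_gt0 ?apm_delta_gt0. Qed.

Lemma Lam_ge : 4 / 3 * expR 1 * (b ^+ 2 / p) <= Lam.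
Proof.
rewrite LamE ler_pdivlMr//.
have es : eps <= p / expR 1 by rewrite -sigmaE; exact: eps_le_sigma.
apply: (@le_trans _ _ (4 / 3 * expR 1 * (b ^+ 2 / p) * (p / expR 1))).
  by rewrite ler_wpM2l// !mulr_ge0 ?expR_ge0 ?sqr_ge0 ?invr_ge0// ltW.
rewrite [leLHS](_ : _ = 4 / 3 * b ^+ 2); last first.
  by field; rewrite !gt_eqF ?expR_gt0.
by rewrite ler_wpM2r ?sqr_ge0//; have := lnm_ge; lra.
Qed.

Lemma apm_LE : L = expR 1 * P + Lam.
Proof.
rewrite /L /apm_L /apm_eta (expR_hi m_ge1 n_ge1 alphaP B_gt0 v_ge0 v_row v_col).
by rewrite mulrC.
Qed.

Lemma apm_L_gt0 : 0 < L.
Proof. by rewrite apm_LE ltr_wpDl ?Lam_gt0// mulr_ge0 ?expR_ge0// ltW. Qed.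

Lemma expR_hiE : expR hi = expR 1 * P.
Proof. by rewrite (expR_hi m_ge1 n_ge1 alphaP B_gt0 v_ge0 v_row v_col) mulrC. Qed.

Lemma apm_q01 : 0 < apm_q alpha B v eps <= 1.
Proof.
rewrite /apm_q -/sigma -/L divr_gt0 ?sigma_gt0 ?apm_L_gt0//=.
rewrite ler_pdivrMr ?apm_L_gt0// mul1r apm_LE sigmaE.
have E := @expR1_ge R; have := Lam_gt0.
have : p / expR 1 <= p.
  by rewrite ler_pdivrMr ?expR_gt0// ler_peMr ?(ltW p_gt0)//; lra.
have : 1 * P <= expR 1 * P by rewrite ler_wpM2r ?(ltW P_gt0)//; lra.
have := p_le_P; lra.
Qed.

Lemma a01 : 0 < a <= 1.
Proof.
have /andP[q0 q1] := apm_q01.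
rewrite /a sqrtr_gt0 q0/=; apply: (@le_trans _ _ (Num.sqrt 1)).
  by rewrite ler_wsqrtr.
by rewrite sqrtr1.
Qed.

Lemma sigma_La : sigma = L * a ^+ 2.
Proof.
have /andP[q0 _] := apm_q01.
by rewrite /a sqr_sqrtr ?ltW// /apm_q -/L mulrC divfK// gt_eqF ?apm_L_gt0.
Qed.

Lemma w_gt0 : 0 < w.
Proof. by rewrite subr_gt0 (lo_lt_hi m_ge1 n_ge1 alphaP B_gt0 v_ge0 v_row v_col). Qed.

Lemma theta01 : 0 <= theta <= 1.
Proof. by rewrite expR_ge0/= -expR0 ler_expR oppr_le0 ltW// w_gt0. Qed.

(** The last component is the energy bound of [upward_energy_step]. *)
Definition apm_invariant (s : 'rV[R]_m * 'rV[R]_m) := forall j,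
  [/\ lo <= s.1 ord0 j <= hi, lo - w <= s.2 ord0 j &
   s.2 ord0 j <= s.1 ord0 j \/
   expR (s.1 ord0 j) - b * s.1 ord0 j +
     L / 2 * (s.2 ord0 j - s.1 ord0 j) ^+ 2 <= expR lo - b * lo].

Lemma apm_gradE x j : apm_grad alpha B v eps x ord0 j = slope_ x j.
Proof.
by rewrite /apm_grad (gradE alphaP B_gt0 v_ge0 v_row apm_delta_gt0) mxE.
Qed.

Lemma apm_next_muE y j : apm_next_mu alpha B v eps y ord0 j =
  Num.max lo (Num.min (y ord0 j - L^-1 * slope_ y j) hi).
Proof. by rewrite mxE apm_gradE. Qed.

Lemma apm_step1 s j : (next s).1 ord0 j =
  Num.max lo (Num.min (s.2 ord0 j - L^-1 * slope_ s.2 j) hi).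
Proof. exact: apm_next_muE. Qed.

Lemma apm_step2 s j : (next s).2 ord0 j = (next s).1 ord0 j +
  (1 - a) / (1 + a) * ((next s).1 ord0 j - s.1 ord0 j).
Proof. by rewrite /apm_step /= !mxE. Qed.

Lemma momentum01 : 0 <= (1 - a) / (1 + a) <= 1.
Proof.
have /andP[a0 a1] := a01.
have a10 : 0 < 1 + a by lra.
rewrite divr_ge0 ?subr_ge0 ?(ltW a10)//= ler_pdivrMr//; lra.
Qed.

Lemma invariant_step s : apm_invariant s -> apm_invariant (next s).
Proof.
move=> inv j; have [box ybox energy] := inv j.
have lohi : lo < hi := lo_lt_hi m_ge1 n_ge1 alphaP B_gt0 v_ge0 v_row v_col.
have /andP[be0 be1] := momentum01.
have box' : lo <= (next s).1 ord0 j <= hi.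
  by rewrite apm_step1 le_max lexx/= ge_max (ltW lohi) ge_min lexx orbT.
split=> //.
  rewrite apm_step2; move: box box' => /andP[x1 x2] /andP[x3 x4].
  set d := _ - s.1 ord0 j; set be := _ / _ in be0 be1 *.
  have dw : - w <= d by rewrite /d /w; lra.
  have : - w <= be * d.
    have [d0|d0] := leP 0 d.
      by apply: (@le_trans _ _ 0); [have := w_gt0; lra|exact: mulr_ge0].
    apply: (le_trans dw); rewrite -subr_ge0 (_ : _ - _ = (1 - be) * - d).
      by rewrite mulr_ge0 ?oppr_ge0 ?subr_ge0// ltW.
    by ring.
  lra.
have hiL : expR hi <= L by rewrite expR_hiE apm_LE lerDl ltW// Lam_gt0.
have gy : expR (s.2 ord0 j) - b <= slope_ s.2 j.
  by rewrite /slope lerD2l lerN2; exact: (spending_le _ alphaP B_gt0 v_ge0 v_row).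
have := upward_energy_step box apm_L_gt0 hiL gy momentum01 energy.
by rewrite apm_step2 apm_step1.
Qed.

Lemma invariant_init (mu0 : 'rV[R]_m) :
  (forall j, muunder alpha B v <= mu0 ord0 j <= mubar alpha B v) ->
  apm_invariant (mu0, mu0).
Proof.
move=> box j /=; have /andP[x1 x2] := box j; have w0 := w_gt0.
split; last by left.
  by rewrite /lo /hi; apply/andP; split; lra.
by rewrite /lo /w in w0 *; lra.
Qed.

Lemma invariant_expR_le s j : apm_invariant s ->
  expR (s.2 ord0 j) <= expR 1 * P + Lam / 2.
Proof.
move=> inv; have [/andP[_ xhi] _ energy] := inv j.
apply: (overshoot_le (x := s.1 ord0 j) p_gt0 p_le_P p_le_b Lam_ge) => //.
by rewrite -apm_LE.
Qed.


Variable xs : 'rV[R]_m.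
Hypothesis xs_box : forall j, lo <= xs ord0 j <= hi.
Hypothesis xs_min : forall x, Phi xs <= Phi x.

Let c := L * a ^+ 2 / (2 * (1 + a)).

(** The coefficient c makes the terms in the squared gradient cancel in
    [contraction_coord]. *)
Definition lyapunov (s : 'rV[R]_m * 'rV[R]_m) : R :=
  Phi s.1 - Phi xs + \sum_j c *
    ((estimate a (s.1 ord0 j) (s.2 ord0 j) - xs ord0 j) ^+ 2 +
     (s.1 ord0 j - xs ord0 j) ^+ 2).

Lemma c_ge0 : 0 <= c.
Proof.
have /andP[a0 _] := a01.
by rewrite divr_ge0 ?mulr_ge0 ?(ltW apm_L_gt0) ?addr_ge0 ?(ltW a0)// sqr_ge0.
Qed.

(** The descent inequality is needed at the curvature
    (e P + Lam / 2) + Lam / 2 = L: one summand for the exponentials, by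
    [invariant_expR_le], and one for the log-sum-exp term. *)
Lemma lyapunov_step s : apm_invariant s ->
  lyapunov (next s) <= (1 - a * theta / 8) * lyapunov s.
Proof.
move=> inv; have inv' := invariant_step inv.
have /andP[a0 a1] := a01; have /andP[th0 th1] := theta01.
set x := s.1; set y := s.2; set x' := (next s).1; set y' := (next s).2.
have yM j : expR (y ord0 j) <= expR 1 * P + Lam / 2 by exact: invariant_expR_le.
have x'M j : expR (x' ord0 j) <= expR 1 * P + Lam / 2.
  have [/andP[_ xhi] _ _] := inv' j.
  apply: (@le_trans _ _ (expR hi)); first by rewrite ler_expR.
  by rewrite expR_hiE lerDl divr_ge0// ltW// Lam_gt0.
have up := Fdelta_le alphaP B_gt0 v_ge0 v_row apm_delta_gt0 x'M yM.
have lowx := Fdelta_ge_tangent alphaP B_gt0 v_ge0 v_row apm_delta_gt0 x y.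
have c_lo : expR (lo - w) = theta * sigma.
  by rewrite expRD mulrC.
have [ylo xslo] : (forall j, theta * sigma <= expR (y ord0 j)) /\
    (forall j, theta * sigma <= expR (xs ord0 j)).
  split=> j; rewrite -c_lo ler_expR; first by have [] := inv j.
  by have /andP[h _] := xs_box j; rewrite (le_trans _ h)// gerBl ltW// w_gt0.
have lows := Fdelta_ge alphaP B_gt0 v_ge0 v_row apm_delta_gt0 xslo ylo.
have L2 : (expR 1 * P + Lam / 2 + b / delta / 2) / 2 = L / 2.
  by rewrite apm_LE /Lam; field; rewrite gt_eqF ?apm_delta_gt0.
rewrite -/delta -/b L2 in up.
pose co j (x y : 'rV[R]_m) := c * ((estimate a (x ord0 j) (y ord0 j) - xs ord0 j) ^+ 2 +
     (x ord0 j - xs ord0 j) ^+ 2).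
have coord j :
    slope_ y j * (x' ord0 j - y ord0 j) + L / 2 * (x' ord0 j - y ord0 j) ^+ 2
    - (1 - a) * (slope_ y j * (x ord0 j - y ord0 j))
    - a * (slope_ y j * (xs ord0 j - y ord0 j) +
           theta * sigma / 2 * (xs ord0 j - y ord0 j) ^+ 2)
    + co j x' y' <= (1 - a * theta / 8) * co j x y.
  have [xbox _ _] := inv j.
  have px := clip_obtuse apm_L_gt0 xbox (apm_step1 s j).
  have ps := clip_obtuse apm_L_gt0 (xs_box j) (apm_step1 s j).
  have := @contraction_coord R a theta L (x ord0 j) (x' ord0 j) (y ord0 j)
    (y' ord0 j) (xs ord0 j) c a01 theta01 (ltW apm_L_gt0) (apm_step2 s j) erefl.
  rewrite -sigma_La -/x -/y -/x' -/y' /co.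
  rewrite -/x -/y -/x' -/y' in px ps.
  have px' := ler_wpM2l (_ : 0 <= 1 - a) px; rewrite subr_ge0 in px'.
  have ps' := ler_wpM2l (ltW a0) ps.
  move: (px' a1) ps'; lra.
have sum_coord := ler_sum (index_enum 'I_m) (fun j (_ : true) => coord j).
move: sum_coord.
rewrite -mulr_sumr !big_split/= !sumrN -!mulr_sumr big_split/= -!mulr_sumr.
rewrite /lyapunov -/x -/y -/x' -/y'.
have gap0 : 0 <= Phi x - Phi xs by rewrite subr_ge0.
have gap1 : 0 <= (1 - theta / 8) * (Phi x - Phi xs) by rewrite mulr_ge0//; lra.
have gap2 := mulr_ge0 (ltW a0) gap1.
have lowx' := ler_wpM2l (_ : 0 <= 1 - a) lowx; rewrite subr_ge0 in lowx'.
have lows' := ler_wpM2l (ltW a0) lows.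
rewrite /co -!mulr_sumr.
move: up (lowx' a1) lows' gap2; lra.
Qed.


Let rho := a * theta / 8.

Lemma rho01 : 0 <= rho <= 1.
Proof.
have /andP[a0 a1] := a01; have /andP[th0 th1] := theta01.
have h0 : 0 <= a * theta by rewrite mulr_ge0// ltW.
have h1 : a * theta <= 1 by rewrite mulr_ile1// ltW.
by rewrite /rho; apply/andP; split; lra.
Qed.

Variable mu0 : 'rV[R]_m.
Hypothesis mu0_box :
  forall j, muunder alpha B v <= mu0 ord0 j <= mubar alpha B v.

Local Notation state := (apm_state alpha B v eps mu0).

Lemma state_invariant t : apm_invariant (state t).
Proof.
by elim: t => [|t IH]; [exact: invariant_init|exact: invariant_step].
Qed.

Lemma lyapunov_state t :
  lyapunov (state t) <= (1 - rho) ^+ t * lyapunov (mu0, mu0).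
Proof.
have /andP[r0 r1] := rho01.
elim: t => [|t IH]; first by rewrite expr0 mul1r.
apply: (le_trans (lyapunov_step (state_invariant t))).
by rewrite exprS -[leRHS]mulrA ler_wpM2l// subr_ge0.
Qed.

Definition initial_bound : R :=
  m%:R * ((expR 1 * P + b) * w + sigma * w ^+ 2) + 1.

Lemma initial_bound_gt0 : 0 < initial_bound.
Proof.
have w0 := w_gt0; rewrite ltr_wpDl// mulr_ge0// addr_ge0//.
  apply: mulr_ge0; last exact: ltW.
  by rewrite addr_ge0 ?(ltW b_gt0)// mulr_ge0 ?expR_ge0// ltW.
by apply: mulr_ge0; [exact/ltW/sigma_gt0|exact: sqr_ge0].
Qed.

Lemma lyapunov_init_le : lyapunov (mu0, mu0) <= initial_bound.
Proof.
have /andP[a0 a1] := a01; have w0 := w_gt0.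
have dist j : `|mu0 ord0 j - xs ord0 j| <= w.
  have /andP[x1 x2] := mu0_box j; have /andP[x3 x4] := xs_box j.
  by rewrite ler_norml /w; rewrite /lo /hi in x3 x4 *; apply/andP; split; lra.
have tangent := Fdelta_ge_tangent alphaP B_gt0 v_ge0 v_row apm_delta_gt0 xs mu0.
have term j : - (slope_ mu0 j * (xs ord0 j - mu0 ord0 j)) +
    c * ((estimate a (mu0 ord0 j) (mu0 ord0 j) - xs ord0 j) ^+ 2 +
         (mu0 ord0 j - xs ord0 j) ^+ 2) <=
    (expR 1 * P + b) * w + sigma * w ^+ 2.
  apply: lerD.
    rewrite -mulrN opprB; apply: (le_trans (ler_norm _)); rewrite normrM.
    apply: ler_pM => //; rewrite ler_norml.
    have sp0 := spending_ge0 delta alphaP B_gt0 v_ge0 v_row mu0 j.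
    have spb := spending_le delta alphaP B_gt0 v_ge0 v_row mu0 j.
    have em : expR (mu0 ord0 j) <= expR 1 * P.
      rewrite -expR_hiE ler_expR /hi; have /andP[_ x2] := mu0_box j; lra.
    have e0 := expR_gt0 (mu0 ord0 j).
    rewrite /slope; apply/andP; split; rewrite -/b in spb *; lra.
  have -> : estimate a (mu0 ord0 j) (mu0 ord0 j) = mu0 ord0 j.
    by rewrite /estimate; field; rewrite gt_eqF.
  set d := mu0 ord0 j - xs ord0 j.
  have dw : d ^+ 2 <= w ^+ 2.
    by rewrite -real_normK ?num_real// lerXn2r ?nnegrE ?(ltW w0)// dist.
  have c2 : 2 * c <= sigma.
    rewrite /c -sigma_La [leLHS](_ : _ = sigma / (1 + a)); last first.
      by field; rewrite gt_eqF//; lra.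
    rewrite ler_pdivrMr; last lra.
    by rewrite ler_peMr ?(ltW sigma_gt0)//; lra.
  apply: (@le_trans _ _ (2 * c * d ^+ 2)).
    by rewrite le_eqVlt; apply/predU1P; left; ring.
  by apply: ler_pM => //; [rewrite mulr_ge0// c_ge0|exact: sqr_ge0].
have := ler_sum (index_enum 'I_m) (fun j (_ : true) => term j).
rewrite big_split/= sumrN sumr_const card_ord -mulr_natl /lyapunov /initial_bound.
move: tangent; rewrite -/delta /=; lra.
Qed.

Lemma gap_le t : Phi (state t).1 - Phi xs <= (1 - rho) ^+ t * initial_bound.
Proof.
have /andP[r0 r1] := rho01.
apply: (@le_trans _ _ (lyapunov (state t))).
  rewrite /lyapunov lerDl sumr_ge0// => j _.
  by rewrite mulr_ge0 ?c_ge0// addr_ge0// sqr_ge0.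
apply: (le_trans (lyapunov_state t)).
by rewrite ler_wpM2l ?exprn_ge0 ?subr_ge0// lyapunov_init_le.
Qed.

(** A gradient step of this inverse length from the box raises no log-price by
    more than 1, so the step stays where exp is at most exp(hi + 1). *)
Definition grad_lipschitz : R := expR (hi + 1) + Lam.

Lemma grad_lipschitz_gt0 : 0 < grad_lipschitz.
Proof. by rewrite addr_gt0 ?expR_gt0 ?Lam_gt0. Qed.

Lemma apm_L_le : L <= grad_lipschitz.
Proof. by rewrite apm_LE -expR_hiE /grad_lipschitz lerD2r ler_expR; lra. Qed.

Lemma grad_lipschitz_le :
  grad_lipschitz <= (expR (hi + 1) * sigma + 2 * lnm * b ^+ 2) / eps.
Proof.
rewrite /grad_lipschitz LamE [leRHS]mulrDl lerD2r ler_pdivlMr//.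
by rewrite ler_pM2l ?expR_gt0// eps_le_sigma.
Qed.

(** A gradient step decreases Phi by the squared gradient over
    2 * grad_lipschitz, and the minimum is over the whole space. *)
Lemma slope_sq_le (x : 'rV[R]_m) : (forall j, lo <= x ord0 j <= hi) ->
  \sum_j slope_ x j ^+ 2 <= 2 * grad_lipschitz * (Phi x - Phi xs).
Proof.
move=> box; have G0 := grad_lipschitz_gt0; set G := grad_lipschitz in G0 *.
pose z : 'rV[R]_m := \row_j (x ord0 j - G^-1 * slope_ x j).
have bG : b <= G.
  have E := @expR1_ge R; have := Lam_ge.
  have : b <= b ^+ 2 / p.
    by rewrite ler_pdivlMr// expr2 ler_pM2l.
  have := expR_gt0 (hi + 1); rewrite /G /grad_lipschitz.
  have b0 : 0 < b ^+ 2 / p by rewrite divr_gt0// exprn_gt0.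
  have : 1 * (b ^+ 2 / p) <= 4 / 3 * expR 1 * (b ^+ 2 / p).
    by rewrite ler_wpM2r ?(ltW b0)//; lra.
  lra.
have zM j : expR (z ord0 j) <= expR (hi + 1).
  rewrite ler_expR mxE; have /andP[_ xhi] := box j.
  apply: lerD => //; rewrite -mulrN ler_pdivrMl// mulr1.
  apply: le_trans bG; rewrite /slope opprB.
  have := spending_le delta alphaP B_gt0 v_ge0 v_row x j; rewrite -/b.
  have := expR_gt0 (x ord0 j); lra.
have xM j : expR (x ord0 j) <= expR (hi + 1).
  by rewrite ler_expR; have /andP[_ xhi] := box j; lra.
have := Fdelta_le alphaP B_gt0 v_ge0 v_row apm_delta_gt0 zM xM.
have := xs_min z.
rewrite (eq_bigr (fun j => - G^-1 * slope_ x j ^+ 2)); last first.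
  by move=> j _; rewrite mxE; ring.
rewrite [X in _ + _ * X](eq_bigr (fun j => G^-1 ^+ 2 * slope_ x j ^+ 2)); last first.
  by move=> j _; rewrite mxE; ring.
rewrite -!mulr_sumr; set S := \sum_j _.
have S0 : 0 <= S by apply: sumr_ge0 => j _; exact: sqr_ge0.
move=> h1 h2.
have h3 : (expR (hi + 1) + b / delta / 2) / 2 * (G^-1 ^+ 2 * S) <=
    G / 2 * (G^-1 ^+ 2 * S).
  apply: ler_wpM2r; first by apply: mulr_ge0 => //; exact: sqr_ge0.
  by rewrite /G /grad_lipschitz -/Lam; have := Lam_gt0; lra.
have h4 : G / 2 * (G^-1 ^+ 2 * S) = G^-1 * S / 2.
  by field; rewrite gt_eqF.
have h5 : G^-1 * S <= 2 * (Phi x - Phi xs).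
  move: h1 h2 h3; rewrite h4 -/b -/delta; lra.
by move: h5; rewrite ler_pdivrMl//; lra.
Qed.

Lemma norm2_apm_grad (x : 'rV[R]_m) :
  norm2 (apm_grad alpha B v eps x) = Num.sqrt (\sum_j slope_ x j ^+ 2).
Proof.
by rewrite /norm2; congr Num.sqrt; apply: eq_bigr => j _; rewrite apm_gradE.
Qed.

Lemma stop_of_small_gap (x : 'rV[R]_m) : (forall j, lo <= x ord0 j <= hi) ->
  2 * grad_lipschitz * (Phi x - Phi xs) <= Num.min (sigma ^+ 2) 1 * eps ^+ 2 ->
  apm_stop alpha B v eps x.
Proof.
move=> box small; rewrite /apm_stop norm2_apm_grad.
have S1 := le_trans (slope_sq_le box) small; set S := \sum_j _ in S1 *.
have s0 := sigma_gt0; have se := eps_le_sigma.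
have e2 : 0 <= eps ^+ 2 := sqr_ge0 eps.
rewrite le_min; apply/andP; split.
  rewrite -[leRHS]ger0_norm; last by rewrite mulr_ge0// ltW.
  rewrite -sqrtr_sqr ler_wsqrtr// (le_trans S1)// exprMn.
  by rewrite ler_wpM2r// ge_min lexx.
rewrite ler_wsqrtr// (le_trans S1)//; apply: (@le_trans _ _ (1 * eps ^+ 2)).
  by rewrite ler_wpM2r// ge_min lexx orbT.
by rewrite mul1r expr2 ler_wpM2r// ltW.
Qed.

(** Minimization over d of slope * d + sigma / 2 * d^2 in each coordinate. *)
Lemma gap_of_stop (x : 'rV[R]_m) : (forall j, lo <= x ord0 j <= hi) ->
  apm_stop alpha B v eps x -> Phi x - Phi xs <= eps / 2.
Proof.
move=> box; rewrite /apm_stop norm2_apm_grad le_min => /andP[_].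
have s0 := sigma_gt0.
rewrite ler_sqrt ?mulr_ge0 ?(ltW s0) ?(ltW eps_gt0)// => S1.
have lob (z : 'rV[R]_m) : (forall j, lo <= z ord0 j <= hi) ->
    forall j, sigma <= expR (z ord0 j).
  by move=> zbox j; rewrite ler_expR; have /andP[] := zbox j.
have := Fdelta_ge alphaP B_gt0 v_ge0 v_row apm_delta_gt0 (lob _ xs_box) (lob _ box).
have term j : - (2 * sigma)^-1 * slope_ x j ^+ 2 <=
   slope_ x j * (xs ord0 j - x ord0 j) + sigma / 2 * (xs ord0 j - x ord0 j) ^+ 2.
  rewrite -subr_ge0.
  rewrite [X in 0 <= X](_ : _ = sigma / 2 * (xs ord0 j - x ord0 j + slope_ x j / sigma) ^+ 2).
    by rewrite mulr_ge0 ?sqr_ge0 ?divr_ge0 ?(ltW s0).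
  by field; rewrite gt_eqF.
have := ler_sum (index_enum 'I_m) (fun j (_ : true) => term j).
rewrite big_split/= -!mulr_sumr -/delta.
have : (2 * sigma)^-1 * \sum_j slope_ x j ^+ 2 <= eps / 2.
  rewrite ler_pdivrMl ?mulr_gt0//; apply: (le_trans S1); rewrite -/sigma; lra.
lra.
Qed.

End Run.

(** * Number of iterations *)

(** Both L and G are at most K1 / eps, so the contraction factor is
    1 - rho with rho of order sqrt eps, and (1 - rho)^T <= exp(- rho T) has to
    fall below eps^3 / D: one factor eps comes from G, two from the target. *)
Lemma iteration_count (R : realType) (C0 K1 K2 sigma theta : R) :
  0 < C0 -> 0 < K1 -> 0 < K2 -> 0 < sigma -> 0 < theta ->
  exists2 C : R, 0 < C & forall eps L G : R,
    0 < eps <= sigma -> 0 < L <= K1 / eps -> 0 <= G <= K1 / eps ->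
    Num.sqrt (sigma / L) * theta / 8 <= 1 ->
    exists2 T : nat,
      T%:R <= C * eps `^ (- 2^-1) * ln (2 + eps^-1) `^ 1 &
      2 * G * ((1 - Num.sqrt (sigma / L) * theta / 8) ^+ T * C0) <=
        K2 * eps ^+ 2.
Proof.
move=> C00 K10 K20 s0 th0.
pose D := 2 * K1 * C0 / K2.
have D0 : 0 < D by rewrite divr_gt0// !mulr_gt0.
pose A := 3 / 2 * `|ln D| + 3.
have A0 : 0 < A by rewrite ltr_wpDl// mulr_ge0.
pose r := Num.sqrt (sigma / K1).
have r0 : 0 < r by rewrite sqrtr_gt0 divr_gt0.
pose C1 := 8 * A / (r * theta).
have C10 : 0 < C1 by rewrite divr_gt0 ?mulr_gt0.
exists (C1 + 3 / 2 * Num.sqrt sigma).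
  by rewrite ltr_pwDl// mulr_ge0// sqrtr_ge0.
move=> eps L G /andP[e0 es] /andP[L0 LK] /andP[G0 GK].
set rho := _ / 8 => rho1.
set ell := ln _.
have es0 : 0 < Num.sqrt eps by rewrite sqrtr_gt0.
have ell_ge : 2 / 3 <= ell.
  apply: (le_trans (@ln2_ge R)).
  by rewrite ler_ln ?posrE ?addr_gt0 ?invr_gt0// lerDl invr_ge0 ltW.
have ell_inv : ln eps^-1 <= ell.
  by rewrite ler_ln ?posrE ?addr_gt0 ?invr_gt0// lerDr.
have powE : eps `^ (- 2^-1) = (Num.sqrt eps)^-1 by rewrite powRN powR12_sqrt// ltW.
rewrite powE powRr1; last by lra.
pose U := C1 * (Num.sqrt eps)^-1 * ell.
have U0 : 0 <= U.
  apply: mulr_ge0; last lra.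
  by apply: mulr_ge0; [exact: ltW|rewrite invr_ge0 ltW].
have /andP[truncU Utrunc] := truncn_itv U0.
exists (Num.truncn U).+1.
  have h1 : 1 <= 3 / 2 * Num.sqrt sigma * (Num.sqrt eps)^-1 * ell.
    have : 1 <= Num.sqrt sigma * (Num.sqrt eps)^-1.
      by rewrite ler_pdivlMr// mul1r ler_wsqrtr.
    have h2 : 0 < ell by lra.
    set q := Num.sqrt sigma * _ => q1.
    have : ell * 1 <= ell * q by rewrite ler_wpM2l// ltW.
    rewrite (_ : 3 / 2 * _ * _ * _ = 3 / 2 * (ell * q)); last by rewrite /q; ring.
    lra.
  rewrite -[_.+1]addn1 natrD [leRHS](_ : _ = U +
    3 / 2 * Num.sqrt sigma * (Num.sqrt eps)^-1 * ell); last by rewrite /U; ring.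
  lra.
set T := (Num.truncn U).+1.
have UT : U <= T%:R by exact: ltW.
have rho_ge : r * Num.sqrt eps * theta / 8 <= rho.
  rewrite /rho ler_wpM2r// ler_wpM2r ?(ltW th0)// /r -sqrtrM ?divr_ge0 ?(ltW s0) ?(ltW K10)//.
  rewrite ler_wsqrtr// -mulrA ler_wpM2l ?(ltW s0)//.
  rewrite -[leLHS]invrK lef_pV2 ?posrE ?invr_gt0 ?mulr_gt0 ?invr_gt0//.
  by rewrite invfM invrK.
have rho0 : 0 <= rho.
  by apply: le_trans rho_ge; rewrite divr_ge0// !mulr_ge0 ?(ltW r0) ?(ltW es0) ?(ltW th0).
have rT : ln (D / eps ^+ 3) <= rho * T%:R.
  have -> : ln (D / eps ^+ 3) = ln D + 3 * ln eps^-1.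
    rewrite lnM ?posrE ?invr_gt0 ?exprn_gt0// -exprVn lnXn ?invr_gt0//.
    by rewrite mulr_natl.
  apply: (@le_trans _ _ (A * ell)).
    have := ler_norm (ln D).
    have : `|ln D| * (2 / 3) <= `|ln D| * ell by rewrite ler_wpM2l.
    rewrite /A; lra.
  apply: (@le_trans _ _ (r * Num.sqrt eps * theta / 8 * U)).
    rewrite le_eqVlt; apply/predU1P; left; rewrite /U /C1; field.
    by rewrite !gt_eqF.
  apply: ler_pM => //.
  by rewrite divr_ge0// !mulr_ge0 ?(ltW r0) ?(ltW es0) ?(ltW th0).
have decay : (1 - rho) ^+ T <= eps ^+ 3 / D.
  apply: (@le_trans _ _ (expR (- rho) ^+ T)).
    by rewrite lerXn2r ?nnegrE ?expR_ge0 ?subr_ge0// expR_ge1Dx.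
  have -> : expR (- rho) ^+ T = (expR (rho * T%:R))^-1.
    rewrite -expRM_natl mulrN expRN.
    by rewrite [T%:R * rho]mulrC.
  have DE0 : 0 < D / eps ^+ 3 by rewrite divr_gt0// exprn_gt0.
  have -> : eps ^+ 3 / D = (D / eps ^+ 3)^-1 by rewrite [RHS]invf_div.
  rewrite lef_pV2 ?posrE ?expR_gt0//.
  by rewrite -(lnK DE0) ler_expR.
apply: (@le_trans _ _ (2 * (K1 / eps) * (eps ^+ 3 / D * C0))).
  apply: ler_pM.
  - by rewrite mulr_ge0.
  - by rewrite mulr_ge0 ?exprn_ge0 ?subr_ge0 ?(ltW C00).
  - by rewrite ler_pM2l.
  - by rewrite ler_wpM2r ?(ltW C00).
rewrite le_eqVlt; apply/predU1P; left; rewrite /D; field.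
by rewrite !gt_eqF.
Qed.

Theorem theorem4p1 (R : realType) (m n : nat) (alpha : \bar R)
    (B : 'rV[R]_n) (v : 'M[R]_(n, m))
    (m_ge1 : (1 <= m)%N) (n_ge1 : (1 <= n)%N)
    (alphaP : alpha = 1%E \/ alpha = +oo%E)
    (B_gt0 : forall i, 0 < B ord0 i)
    (v_ge0 : forall i j, 0 <= v i j)
    (v_row : forall i, row i v != 0)
    (v_col : forall j, col j v != 0)
    (mu0 : 'rV[R]_m)
    (mu0_box : forall j,
       muunder alpha B v <= mu0 ord0 j <= mubar alpha B v) :
  exists C k : R, [/\ 0 < C, 0 < k &
    forall eps : R, 0 < eps <= expR (muunder alpha B v - 1) ->
      exists t : nat,
        [/\ apm_stops_at alpha B v eps mu0 t,
            t%:R <= C * eps `^ (- 2^-1) * (ln (2 + eps^-1)) `^ k &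
            eps_CE_price alpha B v eps
              (map_mx (@expR R) (apm_mu alpha B v eps mu0 t))]].
Proof.
pose sigma := apm_sigma alpha B v.
have s0 : 0 < sigma := expR_gt0 _.
pose hi := mubar alpha B v + 1; pose lo := muunder alpha B v - 1.
pose b := norm1 B.
have b0 : 0 < b := norm1B_gt0 n_ge1 B_gt0.
pose K1 := expR (hi + 1) * sigma + 2 * ln m.+1%:R * b ^+ 2.
have l0 : 0 < ln m.+1%:R :> R by apply: lnm_gt0.
have K10 : 0 < K1 by rewrite addr_gt0// !mulr_gt0 ?expR_gt0 ?exprn_gt0.
have C00 := initial_bound_gt0 m_ge1 n_ge1 alphaP B_gt0 v_ge0 v_row v_col.
have K20 : 0 < Num.min (sigma ^+ 2) 1 by rewrite lt_min exprn_gt0// ltr01.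
have [C C_gt0 count] := iteration_count C00 K10 K20 s0
  (expR_gt0 (- (hi - lo))).
exists C, 1; split=> // eps /andP[e0 eS].
have d0 := apm_delta_gt0 m_ge1 n_ge1 B_gt0 e0.
have dsmall := apm_delta_small m_ge1 n_ge1 alphaP B_gt0 v_ge0 v_row v_col e0 eS.
have [xs [xs_box xs_min]] :=
  Fdelta_minimizer m_ge1 n_ge1 alphaP B_gt0 v_ge0 v_row v_col d0 dsmall.
pose G := grad_lipschitz alpha B v eps.
have G0 : 0 < G by apply: grad_lipschitz_gt0.
have GK : G <= K1 / eps by apply: grad_lipschitz_le.
have L0 : 0 < apm_L alpha B v eps by apply: apm_L_gt0.
have LK : apm_L alpha B v eps <= K1 / eps.
  by apply: le_trans GK; apply: apm_L_le.
have rho1 : Num.sqrt (sigma / apm_L alpha B v eps) * expR (- (hi - lo)) / 8 <= 1.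
  by have /andP[] : 0 <= Num.sqrt (apm_q alpha B v eps) * expR (- (hi - lo)) / 8 <= 1
    by apply: rho01.
have eps_range : 0 < eps <= sigma by rewrite e0.
have L_range : 0 < apm_L alpha B v eps <= K1 / eps by rewrite L0.
have G_range : 0 <= G <= K1 / eps by rewrite (ltW G0).
have [T T_le T_small] := count eps _ G eps_range L_range G_range rho1.
have box t j : lo <= apm_mu alpha B v eps mu0 t ord0 j <= hi.
  by have /(_ j)[] : apm_invariant alpha B v eps (apm_state alpha B v eps mu0 t)
    by apply: state_invariant.
have stopT : apm_stop alpha B v eps (apm_mu alpha B v eps mu0 T).
  apply: (stop_of_small_gap m_ge1 n_ge1 alphaP B_gt0 v_ge0 v_row v_col e0 eS
    xs_min (box T)).
  apply: le_trans T_small; rewrite ler_wpM2l ?mulr_ge0 ?(ltW G0)//.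
  by apply: gap_le.
have ex_stop : exists t, `[< apm_stop alpha B v eps (apm_mu alpha B v eps mu0 t) >].
  by exists T; exact/asboolP.
case: (ex_minnP ex_stop) => t /asboolP stopt tmin.
exists t; split.
- split=> // s st stops; move: st; rewrite ltnNge => /negP; apply.
  by apply: tmin; exact/asboolP.
- apply: le_trans T_le; rewrite ler_nat; apply: tmin; exact/asboolP.
apply: (eps_CE_of_Fdelta_gap alphaP B_gt0 v_ge0 v_row d0 xs_min).
  exact: (gap_of_stop m_ge1 n_ge1 alphaP B_gt0 v_ge0 v_row e0 xs_box (box t)).
by rewrite apm_smoothing.
Qed.
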